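(* Let $K, L \subset \mathbb{R}^d$ be convex bodies containing the origin in their interiors with $K \subseteq L$, and let $F$ be a linear subspace of $\mathbb{R}^d$. Assume that $K$ is a largest-volume member of $\mathcal{R}_F(K)$ contained in $L$. Then there exist contact pairs $(v_1,p_1),\dots,(v_m,p_m)$ of $K$ and $L$ and positive weights $\alpha_1,\dots,\alpha_m$ such that \[ P_F\Big(\sum_{i=1}^m \alpha_i\, p_i\otimes v_i\Big)P_F = P_F,\quad \sum_{i=1}^m \alpha_i p_i = 0,\quad \operatorname{tr}\Big(\sum_{i=1}^m \alpha_i\, p_i\otimes v_i\Big)=\sum_{i=1}^m\alpha_i = d, \] and \[ \sum_{i=1}^m \alpha_i\, p_i\otimes v_i=\sum_{i=1}^m \alpha_i\, v_i\otimes p_i. \]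
   Context: A convex body is a compact convex set with nonempty interior. For a linear subspace $F\subseteq\mathbb{R}^d$, an $F$-operator is an invertible linear operator $A$ on $\mathbb{R}^d$ such that $F$ and $F^\perp$ are invariant subspaces of $A$ and the restriction of $A$ to $F^\perp$ is a nonzero multiple of the identity on $F^\perp$. For $S\subseteq\mathbb{R}^d$, the rotated positions of $S$ with axis $F$ are $\mathcal{R}_F(S)=\{RAS+z:\ R\in O(d),\ A \text{ an } F\text{-operator},\ z\in\mathbb{R}^d\}$. $P_F$ is orthogonal projection onto $F$. The polar of $S$ is $S^\circ=\{p:\langle x,p\rangle\le1\ \forall x\in S\}$. For convex bodies $K\subseteq L$, a contact pair of $K$ and $L$ is a pair $(v,p)$ with $v\in\partial K\cap\partial L$, $p\in\partial K^\circ\cap\partial L^\circ$, $\langle p,v\rangle=1$. For vectors $p,v$, $p\otimes v$ is the operator $x\mapsto\langle v,x\rangle p$. *)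

(* Defs.v *)
(* R : realType, points of R^d are row vectors 'rV[R]_d,
   linear operators are d x d matrices acting on the RIGHT: x |-> x *m A. *)
From HB Require Import structures.
From mathcomp Require Import all_boot all_order all_algebra.
From mathcomp Require Import all_classical all_reals all_analysis.
Set Implicit Arguments. Unset Strict Implicit. Unset Printing Implicit Defensive.
Import Order.TTheory GRing.Theory Num.Theory.
Import numFieldNormedType.Exports.
Local Open Scope classical_set_scope.
Local Open Scope ring_scope.

Section Defs.
Variables (R : realType) (d : nat).
Notation vec := 'rV[R]_d.

Definition dotp (x y : vec) : R := (x *m y^T) 0 0.

Definition convex_set (S : set vec) : Prop :=
  forall x y t, S x -> S y -> 0 <= t <= 1 -> S ((1 - t) *: x + t *: y).

Definition convex_body (S : set vec) : Prop :=
  convex_set S /\ compact S /\ (interior S !=set0).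

Definition bd (S : set vec) : set vec := closure S `\` interior S.

Definition polar (S : set vec) : set vec :=
  [set p | forall x, S x -> dotp x p <= 1].

Definition box (a b : vec) : set vec :=
  [set x | forall i, a 0 i <= x 0 i <= b 0 i].

Definition volume (S : set vec) : \bar R :=
  ereal_inf [set s : \bar R | exists a b : nat -> vec,
     (forall n i, a n 0 i <= b n 0 i) /\
     S `<=` \bigcup_n box (a n) (b n) /\
     s = (\sum_(n <oo) ((\prod_(i < d) (b n 0 i - a n 0 i))%:E))%E].

(* linear subspace F is the row space of a matrix F (mxalgebra) ;
   F^perp = { x | x *m F^T = 0 } = row space of kermx F^T *)
Definition perp (F : 'M[R]_d) : 'M[R]_d := kermx F^T.

Definition F_operator (F A : 'M[R]_d) : Prop :=
  A \in unitmx /\ (F *m A <= F)%MS /\ (perp F *m A <= perp F)%MS /\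
  exists c : R, c != 0 /\ forall x : vec, (x <= perp F)%MS -> x *m A = c *: x.

Definition orthogonal_mx (Q : 'M[R]_d) : Prop := Q *m Q^T = 1%:M.

Definition rotated_positions (F : 'M[R]_d) (S : set vec) : set (set vec) :=
  [set S' | exists (Q A : 'M[R]_d) (z : vec),
     orthogonal_mx Q /\ F_operator F A /\
     S' = [set x *m A *m Q + z | x in S]].

Definition projF (F : 'M[R]_d) : 'M[R]_d :=
  let B := row_base F in B^T *m invmx (B *m B^T) *m B.

(* the operator p (x) v : x |-> <v, x> p, as a matrix acting on the right *)
Definition tensor (p v : vec) : 'M[R]_d := v^T *m p.

Definition contact_pair (K L : set vec) (v p : vec) : Prop :=
  bd K v /\ bd L v /\ bd (polar K) p /\ bd (polar L) p /\ dotp p v = 1.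

End Defs.

(* Main.v *)
Require Import Defs.
From HB Require Import structures.
From mathcomp Require Import all_boot all_order all_algebra.
From mathcomp Require Import all_classical all_reals all_analysis.
From mathcomp Require Import measurable_realfun ring lra.
Set Implicit Arguments. Unset Strict Implicit. Unset Printing Implicit Defensive.
Import Order.TTheory GRing.Theory Num.Theory.
Import numFieldNormedType.Exports.
Local Open Scope classical_set_scope.
Local Open Scope ring_scope.

(** Let [P] be the orthogonal projection onto [F].  The contact pairs are exactly
    the [(v, p)] in [K x L°] with [<v, p> = 1]; they form a compact set, which is
    sent to a finite-dimensional space by
    [(v, p) |-> (P T P, T - T^T, p)] with [T = p (x) v].  By Caratheodory's theorem
    the convex hull of the image is compact.  If it contains [(P / d, 0, 0)], the
    convex combination, multiplied by [d], is the required decomposition.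
    Otherwise a separating functional is a triple (an [F]-operator
    [H = P Y P - k], a skew matrix [S], a translation [z]) with [0 < tr H] and
    [<v (H + S) + z, p> < 0] on all contact pairs.  Following
    [1 + e H], the Cayley transform of [e S / 2] and [e z] for a small [e > 0], a
    compactness argument on [K x L°] and the bipolar theorem keep the image of [K]
    inside [L], while [det (1 + e H) > 1]: its volume is larger than that of [K]. *)

(** * Volume as an outer measure *)

Section Volume.
Variables (R : realType) (d : nat).
Notation vec := 'rV[R]_d.+1.

Definition box_content (a b : vec) : R := \prod_(i < d.+1) (b 0 i - a 0 i).

Lemma box_content_ge0 (a b : vec) :
  (forall i, a 0 i <= b 0 i) -> 0 <= box_content a b.
Proof. by move=> ab; apply: prodr_ge0 => i _; rewrite subr_ge0. Qed.

Lemma box_content00 : box_content 0 0 = 0.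
Proof. by rewrite /box_content big_ord_recl subrr mul0r. Qed.

Lemma volume_le_cover (S : set vec) (a b : nat -> vec) :
  (forall n i, a n 0 i <= b n 0 i) -> S `<=` \bigcup_n box (a n) (b n) ->
  (volume S <= \sum_(n <oo) (box_content (a n) (b n))%:E)%E.
Proof. by move=> ab Sab; apply: ereal_inf_lbound; exists a, b. Qed.

Lemma volume_le_finite_cover N (S : set vec) (a b : nat -> vec) :
  (forall n i, a n 0 i <= b n 0 i) ->
  (forall x, S x -> exists2 n, (n < N)%N & box (a n) (b n) x) ->
  (volume S <= (\sum_(n < N) box_content (a n) (b n))%:E)%E.
Proof.
move=> ab Sab.
(* Beyond [N] the family is padded with the degenerate box from [0] to [0], whose content vanishes
   because the dimension [d.+1] is positive. *)
pose a' n := if (n < N)%N then a n else 0; pose b' n := if (n < N)%N then b n else 0.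
have ab' n i : a' n 0 i <= b' n 0 i by rewrite /a' /b'; case: ifP.
apply: (le_trans (volume_le_cover ab' _)).
  by move=> x /Sab[n nN abx]; exists n => //; rewrite /a' /b' nN.
rewrite (nneseries_split 0 N)/=; last by move=> k _; rewrite lee_fin box_content_ge0.
rewrite eseries0 ?adde0; last first.
  by move=> k; rewrite add0n => Nk _; rewrite /a' /b' ltnNge Nk/= box_content00.
rewrite add0n big_mkord -sumEFin; apply: lee_sum => i _.
by rewrite /a' /b' ltn_ord.
Qed.

Lemma volume_box_le (a b : vec) : (forall i, a 0 i <= b 0 i) ->
  (volume (box a b) <= (box_content a b)%:E)%E.
Proof.
move=> ab; have := @volume_le_finite_cover 1 (box a b) (fun=> a) (fun=> b).
by rewrite big_ord1; apply => // x abx; exists 0%N.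
Qed.

Lemma volume_ge0 (S : set vec) : (0 <= volume S)%E.
Proof.
apply: le_ereal_inf_tmp => _ [a [b [ab [_ ->]]]].
by apply: nneseries_ge0 => n _ _; rewrite lee_fin box_content_ge0.
Qed.

Lemma le_volume (S S' : set vec) : S `<=` S' -> (volume S <= volume S')%E.
Proof.
move=> SS'; apply: ereal_inf_le_tmp => _ [a [b [ab [S'ab ->]]]].
by exists a, b; split => //; split => //; exact: subset_trans S'ab.
Qed.

Lemma volume_cover_eps (S : set vec) (e : R) : 0 < e -> volume S != +oo%E ->
  exists ab : nat -> vec * vec,
    [/\ forall n i, (ab n).1 0 i <= (ab n).2 0 i,
        S `<=` \bigcup_n box (ab n).1 (ab n).2 &
        (\sum_(n <oo) (box_content (ab n).1 (ab n).2)%:E <= volume S + e%:E)%E].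
Proof.
move=> e0 Soo.
have Sfin : volume S \is a fin_num by rewrite ge0_fin_numE ?volume_ge0// ltey.
have [_ [a [b [ab [Sab ->]]]] /ltW le] := lb_ereal_inf_adherent e0 Sfin.
by exists (fun n => (a n, b n)).
Qed.

Lemma volume_sigma_subadditive (S : nat -> set vec) :
  (volume (\bigcup_n S n) <= \sum_(n <oo) volume (S n))%E.
Proof.
have [[n Sn]|/forallNP Sfin] := pselect (exists n, volume (S n) = +oo%E).
  rewrite (@eseries_pinfty _ _ _ n) ?leey// => k _.
  by rewrite gt_eqF// (lt_le_trans _ (volume_ge0 _)).
apply/lee_addgt0Pr => e e0.
apply: le_trans (epsilon_trick xpredT (fun n => volume_ge0 (S n)) (ltW e0)).
have en n : 0 < e / (2 ^ n.+1)%:R by rewrite divr_gt0// ltr0n expn_gt0.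
have [G PG] := @choice _ _ _ (fun n => volume_cover_eps (en n) (introN eqP (Sfin n))).
(* A bijection from [nat] to [nat * nat] merges the covers of all the [S n] into one sequence of
   boxes; the total content is then regrouped as a double sum of nonnegative terms. *)
have /card_esym/ppcard_eqP[f] := card_nat2.
pose F (q : nat * nat) := (box_content (G q.1 q.2).1 (G q.1 q.2).2)%:E.
have F0 q : (0 <= F q)%E by rewrite lee_fin box_content_ge0//; case: (PG q.1).
apply: le_trans (@volume_le_cover _ (fun n => (G (f n).1 (f n).2).1)
  (fun n => (G (f n).1 (f n).2).2) _ _) _.
- by move=> n; case: (PG (f n).1).
- move=> x [n _ Snx]; have [_ /(_ x Snx)[k _ Gx] _] := PG n.
  by exists (f^-1%FUN (n, k)) => //=; rewrite invK ?inE.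
rewrite nneseries_esumT; last by move=> n; exact: (F0 (f n)).
rewrite -(@reindex_esum _ _ _ setT setT f F); last exact: bij.
rewrite -(_ : setT `*`` (fun=> setT) = setT); last by apply/seteqP; split.
rewrite -(@esum_esum _ _ _ setT (fun=> setT) (fun n k => F (n, k)))//.
rewrite -nneseries_esumT; last by move=> n; apply: esum_ge0.
apply: lee_nneseries => n _; first by move=> _; apply: esum_ge0.
rewrite -nneseries_esumT//.
by case: (PG n).
Qed.

(** Countable subadditivity carries the bound from boxes to all sets: the images of the boxes
    covering [S] cover the image of [S]. *)
Lemma volume_image_le (f : vec -> vec) (c : R) (S : set vec) : 0 < c ->
  (forall a b : vec, (forall i, a 0 i <= b 0 i) ->
    (volume (f @` box a b) <= (c * box_content a b)%:E)%E) ->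
  (volume (f @` S) <= c%:E * volume S)%E.
Proof.
move=> c0 fbox; rewrite -lee_pdivrMl//.
apply: le_ereal_inf_tmp => _ [a [b [ab [Sab ->]]]].
rewrite lee_pdivrMl// -nneseriesZl//; last first.
  by move=> n _; rewrite lee_fin box_content_ge0.
apply: le_trans (_ : (volume (\bigcup_n (f @` box (a n) (b n))) <= _)%E).
  by apply: le_volume => _ [x /Sab[n _ abx] <-]; exists n => //; exists x.
apply: le_trans (volume_sigma_subadditive _) _.
apply: lee_nneseries => n _; first by move=> _; exact: volume_ge0.
by rewrite -EFinM; exact: fbox.
Qed.

Lemma volume_translate_le (z : vec) (S : set vec) :
  (volume [set (x + z)%R | x in S] <= volume S)%E.
Proof.
rewrite -[leRHS]mul1e; apply: volume_image_le => // a b ab.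
rewrite mul1r; apply: le_trans (_ : (volume (box (a + z) (b + z)) <= _)%E).
  by apply: le_volume => _ [x abx <-] i; rewrite !mxE !lerD2r.
apply: le_trans (volume_box_le _) _; first by move=> i; rewrite !mxE lerD2r.
rewrite lee_fin le_eqVlt; apply/orP; left; apply/eqP/eq_bigr => i _.
by rewrite !mxE; ring.
Qed.


(** Bounds the excess content when the sides of a box are widened by a multiple of a small [t]; the
    inductive constant absorbs the quadratic term through [t ^+ 2 <= t] on [[0, 1]]. *)
Lemma prod_affine_le (I : Type) (s : seq I) (P : pred I) (l c : I -> R) :
  (forall i, 0 <= l i) -> (forall i, 0 <= c i) ->
  exists2 M, 0 <= M & forall t, 0 <= t <= 1 ->
    \prod_(i <- s | P i) (l i + t * c i) <= \prod_(i <- s | P i) l i + t * M.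
Proof.
move=> l0 c0; elim: s => [|i s [M M0 IH]].
  by exists 0 => // t _; rewrite !big_nil mulr0 addr0.
have p0 : 0 <= \prod_(j <- s | P j) l j by exact: prodr_ge0.
exists (if P i then l i * M + c i * (\prod_(j <- s | P j) l j + M) else M).
  by case: ifP => // _; rewrite addr_ge0 ?mulr_ge0 ?addr_ge0.
move=> t t01; rewrite !big_cons; case: ifP => [_|_]; last exact: IH.
have /andP[t0 t1] := t01.
apply: le_trans (ler_wpM2l _ (IH _ t01)) _; first by rewrite addr_ge0 ?mulr_ge0.
have := c0 i; have : 0 <= (1 - t) * (t * (c i * M)) by rewrite !mulr_ge0 ?subr_ge0.
by nra.
Qed.

Lemma slab_index N (a h x : R) : a <= x <= a + N.+1%:R * h ->
  exists2 k, (k < N.+1)%N & a + k%:R * h <= x <= a + k.+1%:R * h.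
Proof.
elim: N => [|N IH] /andP[ax xb].
  by exists 0%N => //; rewrite mul0r addr0 ax.
have [xN|/ltW xN] := leP x (a + N.+1%:R * h).
  by have [|k kN kx] := IH; [rewrite ax|exists k => //; rewrite ltnW].
by exists N.+1 => //; rewrite xN.
Qed.

(** The elementary factor for linear changes of variables: it sends the basis vector of index [r] to
    [w] and fixes the others, which combines a dilation along one axis with a shear. *)
Definition row_replacement (r : 'I_d.+1) (w : vec) : 'M[R]_d.+1 :=
  \matrix_(i, j) if i == r then w 0 j else (i == j)%:R.

Lemma mul_row_replacement (r : 'I_d.+1) (w x : vec) (j : 'I_d.+1) :
  (x *m row_replacement r w) 0 j = x 0 r * w 0 j + (x 0 j) *+ (j != r).
Proof.
rewrite mxE (bigD1 r)//= mxE eqxx; congr (_ + _).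
have [->|jr] := eqVneq j r.
  by rewrite big1 ?mulr0n// => i ir; rewrite mxE (negPf ir) mulr0.
rewrite (bigD1 j)//= mxE (negPf jr) eqxx mulr1 big1 ?addr0// => i /andP[ir ij].
by rewrite mxE (negPf ir) (negPf ij) mulr0.
Qed.

Lemma det_row_replacement (r : 'I_d.+1) (w : vec) :
  \det (row_replacement r w) = w 0 r.
Proof.
rewrite (expand_det_row _ r) (bigD1 r)//= mxE eqxx big1 ?addr0; last first.
  (* Deleting row [r] and column [j] leaves a zero row: the only nonzero entry of row [j] lies in
     column [j]. *)
  move=> j jr; rewrite /cofactor.
  have [k kE] : exists k, j = lift r k.
    by case: (unliftP r j) jr => [k ->|->]; [exists k|rewrite eqxx].
  rewrite (expand_det_row _ k) big1 ?mulr0// => m _.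
  by rewrite !mxE -kE (negPf jr) (negPf (neq_lift j m)) mul0r.
rewrite /cofactor addnn -signr_odd odd_double mul1r.
rewrite (_ : row' _ _ = 1%:M) ?det1 ?mulr1//.
by apply/matrixP => i j; rewrite !mxE eq_sym (negPf (neq_lift r i)) (inj_eq lift_inj).
Qed.

(** The box is cut into [N.+1] slabs of thickness [h] across axis [r]. The image of each slab lies
    in a box of side [|w_r| h] along axis [r] and [l j + 2 |w_j| h] along the others, so the total
    content tends to the stated bound as [N] grows. *)
Lemma volume_row_replacement_box (r : 'I_d.+1) (w a b : vec) : w 0 r != 0 ->
  (forall i, a 0 i <= b 0 i) ->
  (volume [set (x *m row_replacement r w)%R | x in box a b]
    <= (`|w 0 r| * box_content a b)%:E)%E.
Proof.
move=> wr ab; pose l j := b 0 j - a 0 j.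
have lab j : 0 <= l j by rewrite subr_ge0.
pose c j := 2 * `|w 0 j| * l r.
have c0 j : 0 <= c j by rewrite !mulr_ge0.
have [M M0 prodM] := prod_affine_le (index_enum _) (fun j => j != r) lab c0.
have Elr : box_content a b = l r * \prod_(j | j != r) l j.
  by rewrite /box_content (bigD1 r).
apply/lee_addgt0Pr => e e0; rewrite -EFinD.
(* Large enough that the error [|w_r| (l r) M / N.+1] coming from the widened sides is at most
   [e]. *)
pose N := Num.truncn (`|w 0 r| * l r * M / e).
have Npos : 0 < N.+1%:R :> R by rewrite ltr0n.
have NM : `|w 0 r| * l r * (N.+1%:R^-1 * M) <= e.
  rewrite [leLHS](_ : _ = `|w 0 r| * l r * M / N.+1%:R); last by field.
  rewrite ler_pdivrMr// [leRHS]mulrC -ler_pdivrMr//.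
  by apply/ltW; rewrite /N truncnS_gt// ?num_real.
pose h := l r / N.+1%:R.
have h0 : 0 <= h by rewrite divr_ge0.
have Nh : N.+1%:R * h = l r by rewrite mulrC divfK// gt_eqF.
pose s k := a 0 r + k%:R * h.
(* With [x 0 r = s k + u] and [0 <= u <= h], coordinate [r] of the image is [(s k + u) w_r], and
   coordinate [j] is [x_j + s k w_j] up to [u w_j]. The minimum and maximum treat both signs of
   [w 0 r]. *)
pose lo k : vec := \row_j if j == r then s k * w 0 r + Num.min 0 (h * w 0 r)
                          else a 0 j + s k * w 0 j - `|w 0 j| * h.
pose hi k : vec := \row_j if j == r then s k * w 0 r + Num.max 0 (h * w 0 r)
                          else b 0 j + s k * w 0 j + `|w 0 j| * h.
have hiE k j : hi k 0 j - lo k 0 j =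
    if j == r then `|w 0 r| * h else l j + N.+1%:R^-1 * c j.
  rewrite !mxE; case: eqP => [_|_].
    have [w0|w0] := leP 0 (w 0 r).
      by rewrite ger0_norm// max_r ?min_l ?mulr_ge0//; ring.
    by rewrite ltr0_norm// max_l ?min_r ?mulr_ge0_le0 ?(ltW w0)//; ring.
  by rewrite /c /h /l; ring.
apply: le_trans (@volume_le_finite_cover N.+1 _ lo hi _ _) _.
- move=> k i; rewrite -subr_ge0 hiE; case: ifP => _; first by rewrite mulr_ge0.
  by rewrite addr_ge0// mulr_ge0// invr_ge0.
- move=> _ [x abx <-]; have [|k kN kx] := @slab_index N (a 0 r) h (x 0 r).
    by rewrite Nh /l addrC subrK abx.
  exists k => // j; rewrite mul_row_replacement !mxE.
  pose u := x 0 r - s k.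
  have u0 : 0 <= u by rewrite subr_ge0; case/andP: kx.
  have uh : u <= h.
    by case/andP: kx => _; rewrite /u /s -natr1 mulrDl mul1r; lra.
  have -> : x 0 r = s k + u by rewrite /u; ring.
  case: eqP => [->|_] /=.
    rewrite mulr0n addr0 [(s k + u) * _]mulrDl !lerD2l ge_min le_max.
    have [w0|/ltW w0] := leP 0 (w 0 r).
      by rewrite mulr_ge0//= ler_wpM2r ?orbT.
    by rewrite ler_wnM2r// mulr_ge0_le0 ?orbT.
  have /andP[ax xb] := abx j.
  have /ler_normlP[] : `|u * w 0 j| <= `|w 0 j| * h.
    by rewrite normrM (ger0_norm u0) mulrC ler_wpM2l.
  by rewrite mulr1n; lra.
rewrite lee_fin.
pose Q := \prod_(j | j != r) (l j + N.+1%:R^-1 * c j).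
rewrite (eq_bigr (fun=> `|w 0 r| * h * Q)); last first.
  move=> k _; rewrite /box_content (bigD1 r)//= hiE eqxx; congr (_ * _).
  by apply: eq_bigr => j jr; rewrite hiE (negPf jr).
rewrite sumr_const card_ord [leLHS](_ : _ = `|w 0 r| * l r * Q); last first.
  by rewrite -Nh; ring.
apply: le_trans (ler_wpM2l _ (prodM N.+1%:R^-1 _)) _.
- by rewrite mulr_ge0.
- by rewrite invr_ge0 ltW//= invf_le1// ler1n.
by rewrite mulrDr Elr [_ * (l r * _)]mulrA lerD2l.
Qed.

Lemma volume_row_replacement (r : 'I_d.+1) (w : vec) (S : set vec) : w 0 r != 0 ->
  (volume [set (x *m row_replacement r w)%R | x in S] <= `|w 0 r|%:E * volume S)%E.
Proof.
move=> wr; apply: volume_image_le; first by rewrite normr_gt0.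
by move=> a b; exact: volume_row_replacement_box.
Qed.

End Volume.

(** * Volume under linear maps *)

Section VolumeLinear.
Variables (R : realType) (d : nat).
Notation vec := 'rV[R]_d.+1.

Lemma row_replacement_row (r : 'I_d.+1) (w : vec) :
  row r (row_replacement r w) = w.
Proof. by apply/rowP => j; rewrite !mxE eqxx. Qed.

Lemma row_replacement_row_neq (r i : 'I_d.+1) (w : vec) : i != r ->
  row i (row_replacement r w) = row i 1%:M.
Proof. by move=> ir; apply/rowP => j; rewrite !mxE (negPf ir). Qed.

(** An upper bound only, which is stable under products; applied to the inverse matrix it yields the
    reverse inequality. *)
Definition volume_bounded (A : 'M[R]_d.+1) := forall S : set vec,
  (volume [set (x *m A)%R | x in S] <= `|\det A|%:E * volume S)%E.

Lemma volume_bounded_mul (A B : 'M[R]_d.+1) :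
  volume_bounded A -> volume_bounded B -> volume_bounded (A *m B).
Proof.
move=> vA vB S; rewrite det_mulmx normrM EFinM.
have -> : [set x *m (A *m B) | x in S]%R = [set y *m B | y in [set x *m A | x in S]]%R.
  by rewrite image_comp; apply: eq_imagel => x _ /=; rewrite mulmxA.
apply: le_trans (vB _) _; rewrite [(_ * `|\det B|%:E)%E]muleC -muleA.
by apply: lee_wpmul2l; rewrite ?lee_fin//; exact: vA.
Qed.

Lemma volume_bounded_row_replacement (r : 'I_d.+1) (w : vec) : w 0 r != 0 ->
  volume_bounded (row_replacement r w).
Proof. by move=> wr S; rewrite det_row_replacement; exact: volume_row_replacement. Qed.

(* If the first [r] rows of [A] are those of the identity, then [A] equals
   [A' *m B], where [B] is the identity with its row [r] replaced by row [r] of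
   [A], and the first [r + 1] rows of [A'] are those of the identity. *)
Lemma volume_bounded_unitmx (A : 'M[R]_d.+1) : A \in unitmx -> volume_bounded A.
Proof.
move=> uA.
suff H k : (k <= d.+1)%N -> forall A : 'M[R]_d.+1, A \in unitmx ->
    (forall i : 'I_d.+1, (i < d.+1 - k)%N -> row i A = row i 1%:M) ->
    volume_bounded A.
  by apply: (H d.+1) => // i; rewrite subnn.
elim: k => [_|k IH kd] {uA}A uA rowA.
  rewrite subn0 in rowA; have -> : A = 1%:M.
    by apply/row_matrixP => i; apply: rowA; rewrite ltn_ord.
  move=> S; rewrite det1 normr1 mul1e.
  by under eq_imagel => x _ do rewrite mulmx1; rewrite image_id.
have rd : (d.+1 - k.+1 < d.+1)%N by rewrite ltn_subrL.
pose r := Ordinal rd.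
have unit_row_replacement (w : vec) : w 0 r != 0 -> row_replacement r w \in unitmx.
  by rewrite unitmxE det_row_replacement unitfE.
have pivot (B : 'M[R]_d.+1) : B \in unitmx -> B r r != 0 ->
    (forall i : 'I_d.+1, (i < r)%N -> row i B = row i 1%:M) -> volume_bounded B.
  move=> uB Brr rowB; pose w := row r B.
  have wr : w 0 r != 0 by rewrite mxE.
  have uw := unit_row_replacement _ wr.
  rewrite -(mulmxKV uw B); apply: volume_bounded_mul; last first.
    exact: volume_bounded_row_replacement.
  apply: IH; first by rewrite ltnW.
    by rewrite unitmx_mul uB unitmx_inv.
  move=> i ik; rewrite row_mul; apply: (can_inj (mulmxK uw)); rewrite mulmxKV//.
  rewrite -row_mul mul1mx; have [->|ir] := eqVneq i r.
    by rewrite row_replacement_row.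
  rewrite row_replacement_row_neq// rowB// ltn_neqAle.
  by rewrite -[(_ == _)%N]/(i == r) ir -ltnS -subSn.
have [Arr|/pivot] := eqVneq (A r r) 0; last exact.
have rowA' (i : 'I_d.+1) : (i < r)%N -> row i A = row i 1%:M by move=> ir; exact: rowA.
(* The pivot is zero. If all entries of row [r] from the diagonal on vanished, this row would be a
   combination of the identity rows above it, and [A] would be singular. *)
have [c Arc] : exists c : 'I_d.+1, (r <= c)%N && (A r c != 0).
  apply/existsP; apply: contraLR uA; rewrite negb_exists => /forallP Ar0.
  pose z : vec := \row_c if (c < r)%N then A r c else 0.
  have zA : z *m A = z.
    rewrite -[RHS]mulmx1 !mulmx_sum_row; apply: eq_bigr => i _.
    by rewrite mxE; case: ifP => [/rowA' ->|]; rewrite ?scale0r.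
  apply/negP => uA; have : (row r 1%:M - z) *m A = 0.
    rewrite mulmxBl zA -row_mul mul1mx; apply/rowP => j; rewrite !mxE.
    by have := Ar0 j; rewrite negb_and -ltnNge negbK; case: ltnP => _ /= => [_|/eqP ->];
      rewrite subrr.
  move/(congr1 (mulmx^~ (invmx A))); rewrite mulmxK// mul0mx.
  move/rowP/(_ r); rewrite !mxE ltnn eqxx subr0 => /eqP; by rewrite oner_eq0.
have /andP[rc {}Arc] := Arc.
have cr : c != r by apply: contraNneq Arc => ->; rewrite Arr.
(* Right multiplication by [row_replacement c (w 1)] adds column [c] to column [r]: the pivot
   becomes [A r c], and the first [r] rows, which vanish in column [c], are unchanged. The value
   [-1] gives the inverse. *)
pose w (e : R) : vec := \row_j ((j == c)%:R + e * (j == r)%:R).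
have w1 e : w e 0 c = 1 by rewrite mxE eqxx (negPf cr) mulr0 addr0.
have ww : row_replacement c (w 1) *m row_replacement c (w (-1)) = 1%:M.
  apply/row_matrixP => i; rewrite row_mul; apply/rowP => j; rewrite mul_row_replacement.
  rewrite !mxE; have [->|ic] := eqVneq i c; rewrite ?eqxx ?(negPf cr) ?[c == j]eq_sym /=.
    by have [->|jc] := eqVneq j c; rewrite ?(negPf cr) /=; ring.
  by have [->|jc] := eqVneq j c; rewrite ?(negPf ic) /=; ring.
rewrite -[A]mulmx1 -ww mulmxA; apply: volume_bounded_mul; last first.
  by apply: volume_bounded_row_replacement; rewrite w1 oner_eq0.
have rowE i j : (A *m row_replacement c (w 1)) i j = A i c * w 1 0 j + A i j *+ (j != c).
  have := mul_row_replacement c (w 1) (row i A) j.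
  by rewrite -row_mul !mxE => ->.
apply: pivot.
- by rewrite unitmx_mul uA unitmxE det_row_replacement w1 unitr1.
- by rewrite rowE Arr mxE eqxx [r == c]eq_sym (negPf cr) mul0rn !addr0 add0r !mulr1.
move=> i ir; rewrite -(rowA' i ir); apply/rowP => j; rewrite mxE rowE.
have ic : i != c by rewrite -val_eqE/= neq_ltn (leq_trans ir rc).
have /rowP Ai := rowA' i ir.
have := Ai c; rewrite !mxE (negPf ic) => ->; rewrite mul0r add0r.
have [->|] := eqVneq j c; rewrite ?mulr1n// mulr0n.
by have := Ai c; rewrite !mxE (negPf ic) => ->.
Qed.

End VolumeLinear.

(** * Volume of boxes *)

Section VolumeBox.
Variable R : realType.

(** Endpoints are sequences indexed by [nat] of which the first [d] coordinates count, so that the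
    induction on [d] keeps the same family of boxes. *)
Definition box_cover_content (d : nat) (a b : nat -> nat -> R) (n : nat) : R :=
  \prod_(i < d) (b n i - a n i).

Lemma box_cover_content_ge0 d (a b : nat -> nat -> R) n :
  (forall n i, a n i <= b n i) -> 0 <= box_cover_content d a b n.
Proof. by move=> ab; apply: prodr_ge0 => i _; rewrite subr_ge0. Qed.

(* Induction on the dimension: for a fixed last coordinate, the boxes of the family
   [P] that meet this slice cover a box of one dimension less; integrate over the
   last coordinate. *)
Lemma box_cover_content_ge (u v : nat -> R) (a b : nat -> nat -> R)
    (d : nat) (P : pred nat) :
  (forall i, u i <= v i) -> (forall n i, a n i <= b n i) ->
  (forall x : nat -> R, (forall i, u i <= x i <= v i) ->
     exists2 n, P n & forall i, (i < d)%N -> a n i <= x i <= b n i) ->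
  ((\prod_(i < d) (v i - u i))%:E
    <= \sum_(n <oo | P n) (box_cover_content d a b n)%:E)%E.
Proof.
move=> uv ab; elim: d P => [|d IH] P cover.
  (* In dimension zero every content is the empty product [1], so one member of the cover
     suffices. *)
  have [|n Pn _] := cover u; first by move=> i; rewrite lexx uv.
  rewrite big_ord0; apply: le_trans (nneseries_lim_ge n.+1 _); last first.
    by move=> k _ _; rewrite lee_fin box_cover_content_ge0.
  rewrite big_mkcond big_nat_recr//= Pn /box_cover_content big_ord0 -[leLHS]add0e.
  rewrite leeD2r//; apply: sume_ge0 => k _; case: ifP => // _.
  by rewrite big_ord0 lee_fin.
pose C n := if P n then box_cover_content d a b n else 0.
have C0 n : 0 <= C n by rewrite /C; case: ifP => // _; exact: box_cover_content_ge0.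
pose I n : set (measurableTypeR R) := `[a n d, b n d]%classic.
pose D : set (measurableTypeR R) := `[u d, v d]%classic.
have mD : measurable D by exact: measurable_itv.
have mI n : measurable (I n) by exact: measurable_itv.
have muitv (x y : R) : x <= y -> lebesgue_measure `[x, y]%classic = (y - x)%:E.
  rewrite le_eqVlt => /predU1P[->|xy]; rewrite lebesgue_measure_itv/= lte_fin.
    by rewrite ltxx subrr.
  by rewrite xy.
have muD : lebesgue_measure D = (v d - u d)%:E by exact: muitv.
have muI n : lebesgue_measure (I n) = (b n d - a n d)%:E by exact: muitv.
pose g n (t : measurableTypeR R) := ((C n)%:E * (\1_(I n) t)%:E)%E.
have g0 n t : (0 <= g n t)%E by rewrite /g -EFinM lee_fin mulr_ge0.
have mg n : measurable_fun D (g n).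
  apply: emeasurable_funM => //; apply/measurable_EFinP.
  exact: measurable_indic.
have slice t : D t -> ((\prod_(i < d) (v i - u i))%:E <= \sum_(n <oo) g n t)%E.
  (* The induction hypothesis is applied to the boxes of [P] whose last side contains [t]; a point
     of the slice is extended by [t] as coordinate [d]. *)
  move=> Dt; apply: le_trans (IH (fun n => P n && (a n d <= t <= b n d)) _) _.
    move=> x uxv; pose x' i := if i == d then t else x i.
    have [|n Pn abx] := cover x'.
      by move=> i; rewrite /x'; case: eqP => // ->; move: Dt; rewrite /D/= in_itv.
    have := abx d (ltnSn d); rewrite /x' eqxx => abt.
    exists n; first by rewrite Pn.
    by move=> i id; have := abx i (ltnW id); rewrite /x' ltn_eqF.
  rewrite eseries_mkcond; apply: lee_nneseries => n _.
    by case: ifP => // _; rewrite lee_fin box_cover_content_ge0.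
  case: ifP => [/andP[Pn abt]|_]; last exact: g0.
  by rewrite /g /C Pn indicE mem_set ?mule1// /I/= in_itv.
have : (\int[lebesgue_measure]_(t in D) (cst (\prod_(i < d) (v i - u i))%:E t) <=
        \int[lebesgue_measure]_(t in D) (\sum_(n <oo) g n t))%E.
  apply: ge0_le_integral => //.
  - by move=> t _; rewrite lee_fin prodr_ge0// => i _; rewrite subr_ge0.
  - exact: ge0_emeasurable_sum.
rewrite integral_cst//= muD -EFinM big_ord_recr/= => /le_trans; apply.
rewrite integral_nneseries// [leRHS]eseries_mkcond; apply: lee_nneseries => n _.
  by move=> _; apply: integral_ge0.
rewrite ge0_integralZl_EFin//; last first.
  by apply/measurable_EFinP; exact: measurable_indic.
rewrite integral_indic//.
(* The integral over [D] only sees the part of the last side inside [D], which is at most its full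
   length. *)
apply: le_trans (_ : ((C n)%:E * lebesgue_measure (I n) <= _)%E).
  apply: lee_wpmul2l; rewrite ?lee_fin//; apply: le_measure; rewrite ?inE//.
  exact: measurableI.
rewrite muI -EFinM /C; case: ifP => // _; last by rewrite mul0r.
by rewrite /box_cover_content big_ord_recr.
Qed.

Variable d : nat.
Notation vec := 'rV[R]_d.+1.

Lemma volume_box_ge (a b : vec) : (forall i, a 0 i <= b 0 i) ->
  ((box_content a b)%:E <= volume (box a b))%E.
Proof.
move=> ab; apply: le_ereal_inf_tmp => _ [a' [b' [ab' [cover ->]]]].
pose c (x : vec) (i : nat) := x 0 (inord i).
have := @box_cover_content_ge (c a) (c b) (fun n => c (a' n)) (fun n => c (b' n))
  d.+1 xpredT.
rewrite (_ : \prod_(i < d.+1) _ = box_content a b); last first.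
  by apply: eq_bigr => i _; rewrite /c inord_val.
move=> /(_ _ _ _)/le_trans; apply; rewrite ?/c//; last first.
- apply: lee_nneseries => n _.
    by move=> _; rewrite lee_fin box_cover_content_ge0// => k i; rewrite /c.
  by rewrite lee_fin le_eqVlt; apply/orP; left; apply/eqP/eq_bigr => i _; rewrite inord_val.
- move=> x abx; have [|n _ nx] := cover (\row_i x i).
    by move=> i; rewrite mxE; have := abx i; rewrite inord_val.
  by exists n => // i id; have := nx (inord i); rewrite mxE inordK.
Qed.

End VolumeBox.

(** * Volumes of bodies and of their affine images *)

Section VolumeBody.
Variables (R : realType) (d : nat).
Notation vec := 'rV[R]_d.+1.

Lemma interior_box (S : set vec) (x : vec) : interior S x ->
  exists2 e : R, 0 < e & box (x - const_mx e) (x + const_mx e) `<=` S.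
Proof.
move=> /nbhs_ballP[e /= e0 eS]; exists (e / 2); first by rewrite divr_gt0.
move=> y xy; apply: eS; rewrite -ball_normE /ball_/=.
apply: le_lt_trans (_ : e / 2 < e); last by lra.
rewrite [leLHS]mx_normrE; apply: bigmax_le => [|[i j] _ /=]; first by rewrite divr_ge0 ?ltW.
rewrite ord1 !mxE ler_norml; have := xy j; rewrite !mxE; lra.
Qed.

Lemma le_mx_norm m n (x : 'M[R]_(m, n)) i j : `|x i j| <= `|x|.
Proof.
rewrite [leRHS]mx_normrE.
exact: (@le_bigmax _ _ _ 0 (fun ij : 'I_m * 'I_n => `|x ij.1 ij.2|) (i, j)).
Qed.

Lemma volume_gt0 (S : set vec) : interior S !=set0 -> (0 < volume S)%E.
Proof.
move=> [x /interior_box[e e0 eS]].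
have ab i : (x - const_mx e) 0 i <= (x + const_mx e) 0 i by rewrite !mxE; lra.
apply: lt_le_trans (le_trans (volume_box_ge ab) (le_volume eS)).
rewrite lte_fin; apply: prodr_gt0 => i _; rewrite !mxE; lra.
Qed.

Lemma compact_norm_le (V : normedModType R) (S : set V) : compact S ->
  exists2 M, 0 < M & forall x, S x -> `|x| <= M.
Proof.
move=> /compact_bounded[M [_ SM]]; exists (`|M| + 1); first by rewrite ltr_wpDl.
by move=> x Sx; apply: SM Sx; rewrite (le_lt_trans (ler_norm M))// ltrDl.
Qed.

Lemma volume_lty (S : set vec) : compact S -> (volume S < +oo)%E.
Proof.
move=> /compact_norm_le[M M0 SM].
apply: le_lt_trans (le_volume (_ : S `<=` box (- const_mx M) (const_mx M))) _.
  move=> x /SM xM i; have := le_trans (le_mx_norm x 0 i) xM.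
  by rewrite !mxE ler_norml.
apply: le_lt_trans (volume_box_le _) (ltry _).
by move=> i; rewrite !mxE; lra.
Qed.

(** Undoing the map sends the image back to [S], so the upper bound for [invmx A] and for the
    inverse translation gives the lower bound for [A]. *)
Lemma volume_affine_ge (A : 'M[R]_d.+1) (z : vec) (S : set vec) : A \in unitmx ->
  (`|\det A|%:E * volume S <= volume [set (x *m A + z)%R | x in S])%E.
Proof.
move=> uA; have detA : 0 < `|\det A| by rewrite normr_gt0 -unitfE -unitmxE.
set S' := [set _ | _ in S].
rewrite -lee_pdivlMl// -normfV -det_inv.
have {1}-> : S = [set (x *m invmx A)%R | x in [set (x + - z)%R | x in S']].
  rewrite !image_comp; apply/seteqP; split => [x Sx|_ [x Sx <-]] /=.
    by exists x => //=; rewrite addrK mulmxK.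
  by rewrite addrK mulmxK.
apply: le_trans (volume_bounded_unitmx _ _) _; first by rewrite unitmx_inv.
by apply: lee_wpmul2l; rewrite ?lee_fin//; exact: volume_translate_le.
Qed.

(** Strictness comes from [0 < volume S < +oo]: the interior contains a cube and compactness gives
    an enclosing one. *)
Lemma volume_affine_gt (A : 'M[R]_d.+1) (z : vec) (S : set vec) :
  compact S -> interior S !=set0 -> 1 < `|\det A| ->
  (volume S < volume [set (x *m A + z)%R | x in S])%E.
Proof.
move=> cS S0 detA; have uA : A \in unitmx.
  by rewrite unitmxE unitfE -normr_gt0 (lt_trans _ detA).
apply: lt_le_trans (volume_affine_ge z S uA).
have Sfin : volume S \is a fin_num by rewrite ge0_fin_numE ?volume_ge0 ?volume_lty.
rewrite -(fineK Sfin) -EFinM lte_fin ltr_pMl// -lte_fin fineK//.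
exact: volume_gt0.
Qed.

End VolumeBody.

(** * Separation and conical combinations *)

Section Dotp.
Variables (R : realType) (n : nat).
Implicit Types x y z : 'rV[R]_n.

Lemma dotpE x y : dotp x y = \sum_i x 0 i * y 0 i.
Proof. by rewrite /dotp mxE; apply: eq_bigr => i _; rewrite mxE. Qed.

Lemma dotpC x y : dotp x y = dotp y x.
Proof. by rewrite !dotpE; apply: eq_bigr => i _; rewrite mulrC. Qed.

Lemma dotpDl x y z : dotp (x + y) z = dotp x z + dotp y z.
Proof. by rewrite /dotp mulmxDl mxE. Qed.

Lemma dotpZl a x y : dotp (a *: x) y = a * dotp x y.
Proof. by rewrite /dotp -scalemxAl mxE. Qed.

Lemma dotpNl x y : dotp (- x) y = - dotp x y.
Proof. by rewrite /dotp mulNmx mxE. Qed.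

Lemma dotp0l y : dotp 0 y = 0.
Proof. by rewrite /dotp mul0mx mxE. Qed.

Lemma dotpDr x y z : dotp z (x + y) = dotp z x + dotp z y.
Proof. by rewrite !(dotpC z) dotpDl. Qed.

Lemma dotpZr a x y : dotp y (a *: x) = a * dotp y x.
Proof. by rewrite !(dotpC y) dotpZl. Qed.

Lemma dotpNr x y : dotp y (- x) = - dotp y x.
Proof. by rewrite !(dotpC y) dotpNl. Qed.

Lemma dotp0r y : dotp y 0 = 0.
Proof. by rewrite dotpC dotp0l. Qed.

Lemma dotp_suml (I : Type) (s : seq I) (F : I -> 'rV[R]_n) y :
  dotp (\sum_(i <- s) F i) y = \sum_(i <- s) dotp (F i) y.
Proof. by rewrite /dotp mulmx_suml summxE. Qed.

Lemma dotp_ge0 x : 0 <= dotp x x.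
Proof. by rewrite dotpE sumr_ge0// => i _; rewrite -expr2 sqr_ge0. Qed.

Lemma dotp_eq0 x : dotp x x = 0 -> x = 0.
Proof.
rewrite dotpE => /eqP; rewrite psumr_eq0; last by move=> i _; rewrite -expr2 sqr_ge0.
by move=> /allP x0; apply/rowP => i; have := x0 i (mem_index_enum i);
  rewrite -expr2 sqrf_eq0 mxE => /eqP.
Qed.

Lemma cvg_dotp (T : Type) (F : set_system T) (f g : T -> 'rV[R]_n) x y :
  Filter F -> f @ F --> x -> g @ F --> y -> dotp (f t) (g t) @[t --> F] --> dotp x y.
Proof.
move=> FF fx gy; rewrite dotpE.
rewrite (_ : (fun t => _) = fun t => \sum_i f t 0 i * g t 0 i); last first.
  by apply/funext => t; rewrite dotpE.
apply: (@cvg_big R _ _ _ _ add_continuous _ _ _ (fun i t => f t 0 i * g t 0 i)) => i _.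
apply: cvgM; [apply: (cvg_comp f (fun z : 'rV_n => z 0 i) fx)|
  apply: (cvg_comp g (fun z : 'rV_n => z 0 i) gy)]; exact: coord_continuous.
Qed.

Lemma cvg_dotp_dist x y : dotp (x - z) (x - z) @[z --> y] --> dotp (x - y) (x - y).
Proof.
have xB : x - z @[z --> y] --> x - y.
  by apply: (@cvgB _ _ _ (nbhs y) _ (cst x) id); [apply: cvg_cst|apply: cvg_id].
exact: (@cvg_dotp _ (nbhs y) (fun z => x - z) (fun z => x - z) _ _ _ xB xB).
Qed.

Lemma dotp_dist_continuous x : continuous (fun z => dotp (x - z) (x - z)).
Proof. by move=> y; apply: cvg_dotp_dist. Qed.

Lemma cvg_dotpl x y : dotp z x @[z --> y] --> dotp y x.
Proof. exact: (@cvg_dotp _ (nbhs y) id (cst x) y x _ cvg_id (cvg_cst x)). Qed.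

Lemma dotpl_continuous x : continuous (fun z => dotp z x).
Proof. by move=> y; apply: cvg_dotpl. Qed.

(** The normal is [x - y], where [y] is the point of [S] nearest to [x]. *)
Lemma separation (S : set 'rV[R]_n) x : compact S -> Defs.convex_set S -> S !=set0 ->
  ~ S x -> exists w c, (forall y, S y -> dotp y w <= c) /\ c < dotp x w.
Proof.
move=> cS convS S0 Sx.
have [|y] := @compact_EVT_min _ _ (fun y => dotp (x - y) (x - y)) S S0 cS.
  exact/continuous_subspaceT/dotp_dist_continuous.
rewrite inE => Sy min_y; exists (x - y), (dotp y (x - y)); split; last first.
  rewrite -subr_gt0 -dotpNl -dotpDl lt_def dotp_ge0 andbT.
  by apply/eqP => /dotp_eq0/eqP; rewrite subr_eq0 => /eqP xy; apply: Sx; rewrite xy.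
move=> z Sz; rewrite -subr_ge0 -opprB oppr_ge0 -dotpNl -dotpDl leNgt; apply/negP.
set D := dotp (z - y) (z - y); set a := dotp _ _ => a0.
have D0 : 0 <= D by exact: dotp_ge0.
have aD : 0 < a + D by rewrite ltr_pwDl.
(* Moving from [y] towards [z] by [t] changes the squared distance by [t (t D - 2 a)]. Here
   [t D = a - t a], so the change is negative, against minimality. *)
pose t := a / (a + D).
have t0 : 0 < t by rewrite divr_gt0.
have t1 : t <= 1 by rewrite ler_pdivrMr// mul1r lerDl.
have := min_y ((1 - t) *: y + t *: z).
have t01 : 0 <= t <= 1 by rewrite ltW.
rewrite inE => /(_ (convS y z t Sy Sz t01)).
have -> : x - ((1 - t) *: y + t *: z) = (x - y) - t *: (z - y).
  by apply/rowP => i; rewrite !mxE; ring.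
move: @D @a D0 a0 aD @t t0 t1 t01; move: (x - y) (z - y) => p q D a D0 a0 aD t t0 t1 t01.
rewrite !dotpDl !dotpDr !dotpNl !dotpNr !dotpZl !dotpZr -/D [dotp p q]dotpC -/a.
move: (dotp p p) => E.
have tE : t * (a + D) = a by rewrite divfK// gt_eqF.
by nra.
Qed.

End Dotp.

Section Conic.
Variables (R : realType) (n : nat).
Notation vec := 'rV[R]_n.
Variable C : set vec.

Definition conic (s : seq (R * vec)) := forall q, q \in s -> 0 <= q.1 /\ C q.2.
Definition conic_sum (s : seq (R * vec)) := \sum_(q <- s) q.1 *: q.2.

Lemma conic_cons q s : conic (q :: s) <-> (0 <= q.1 /\ C q.2) /\ conic s.
Proof.
split=> [h|[hq hs] q']; last by rewrite inE => /predU1P[->|/hs].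
by split=> [|q' q's]; apply: h; rewrite inE ?eqxx ?q's ?orbT.
Qed.

(** More than [n] vectors are linearly dependent; subtracting a multiple of the dependence removes
    one vector and keeps all weights nonnegative. *)
Lemma conic_caratheodory s : conic s ->
  exists s', [/\ conic s', conic_sum s' = conic_sum s & (size s' <= n)%N].
Proof.
have [k] := ubnP (size s); elim: k s => // k IH s; rewrite ltnS => sk Cs.
have [sn|sn] := leqP (size s) n; first by exists s.
pose m := size s; pose v i := (tnth (in_tuple s) i).2; pose a i := (tnth (in_tuple s) i).1.
have Ca i : 0 <= a i /\ C (v i) by apply: Cs; exact: mem_tnth.
have sE : conic_sum s = \sum_i a i *: v i by rewrite /conic_sum big_tnth.
pose M := \matrix_(i < m) v i.
have [u [uM [i0 ui0]]] : exists u : 'rV[R]_m, u *m M = 0 /\ exists i, 0 < u 0 i.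
  have : kermx M != 0.
    rewrite kermx_eq0; apply/negP => /eqP rM; have := rank_leq_col M.
    by rewrite rM leqNgt sn.
  case/rowV0Pn => u /sub_kermxP uM /rV0Pn[i].
  rewrite neq_lt => /orP[ui|ui]; last by exists u; split => //; exists i.
  by exists (- u); rewrite mulNmx uM oppr0; split => //; exists i; rewrite mxE oppr_gt0.
(* The least ratio [a i / u 0 i] over the positive [u 0 i] is the largest multiple that leaves every
   weight nonnegative, and it cancels the weight at [i1]. *)
case: (@arg_minP _ _ _ i0 (fun i => 0 < u 0 i) (fun i => a i / u 0 i) ui0) => /= i1 ui1 min1.
pose r := a i1 / u 0 i1; pose b i := a i - r * u 0 i.
have r0 : 0 <= r by have [ai1 _] := Ca i1; apply: divr_ge0 => //; exact: ltW.
have b0 i : 0 <= b i.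
  rewrite subr_ge0; have [ui|ui] := ltP 0 (u 0 i).
    by rewrite -ler_pdivlMr//; exact: min1.
  by apply: le_trans (proj1 (Ca i)); exact: mulr_ge0_le0.
have bi1 : b i1 = 0 by rewrite /b /r divfK ?subrr// gt_eqF.
have sumb : \sum_i b i *: v i = conic_sum s.
  rewrite sE; under eq_bigr do rewrite scalerBl -scalerA.
  have : \sum_i u 0 i *: v i = 0.
    by rewrite -[RHS]uM mulmx_sum_row; apply: eq_bigr => i _; rewrite rowK.
  by rewrite sumrB -scaler_sumr => ->; rewrite scaler0 subr0.
pose s' := [seq (b i, v i) | i <- enum (predC1 i1)].
have [||s'' [Cs'' s''E s''n]] := IH s'.
- by rewrite size_map -cardE cardC1 card_ord (leq_trans _ sk)// ltn_predL (leq_ltn_trans _ sn).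
- by move=> q /mapP[i _ ->] /=; split; [exact: b0|case: (Ca i)].
exists s''; split => //; rewrite s''E -sumb /conic_sum big_map big_enum/=.
by rewrite [RHS](bigD1 i1)//= bi1 scale0r add0r.
Qed.

(** Sums of [m] multiples of points of [C] with coefficients in [[0, 1]], written as iterated
    continuous images of products so that compactness follows by induction. *)
Fixpoint truncated_cone (m : nat) : set vec :=
  if m is k.+1 then
    [set q.1 + q.2.1 *: q.2.2 | q in truncated_cone k `*` (`[0, 1]%classic `*` C)]
  else [set 0].

Lemma compact_truncated_cone m : compact C -> compact (truncated_cone m).
Proof.
move=> cC; elim: m => [|m IH]; first exact: compact_set1.
apply: (@continuous_compact _ _ (fun q : vec * (R * vec) => q.1 + q.2.1 *: q.2.2)).
  apply: continuous_subspaceT => q; apply: cvgD; first exact: cvg_fst.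
  apply: cvgZ; [apply: (continuous_comp (f := snd) (g := fst))|
    apply: (continuous_comp (f := snd) (g := snd))];
    solve [exact: cvg_fst | exact: cvg_snd].
by apply: compact_setX => //; apply: compact_setX => //; exact: segment_compact.
Qed.

Lemma truncated_cone_conic m x : truncated_cone m x ->
  exists2 s, conic s & x = conic_sum s.
Proof.
elim: m x => [x ->|m IH _ [[y [a v]] /= [/IH[s Cs ->] [a01 Cv]] <-]].
  by exists [::] => //; rewrite /conic_sum big_nil.
exists ((a, v) :: s); last by rewrite /conic_sum big_cons addrC.
apply/conic_cons; split => //=; split => //.
by move: a01; rewrite in_itv/= => /andP[].
Qed.

Lemma conic_truncated_cone m s : C !=set0 -> conic s ->
  (forall q, q \in s -> q.1 <= 1) -> (size s <= m)%N -> truncated_cone m (conic_sum s).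
Proof.
move=> [v0 Cv0]; elim: m s => [|m IH] [|[a v] s]//=.
- by move=> _ _ _; rewrite /conic_sum big_nil.
(* Lists shorter than [m] are padded with the zero multiple of [v0]. *)
- move=> _ _ _; exists (0, (0, v0)); last by rewrite /conic_sum big_nil scale0r addr0.
  split; last by rewrite /= in_itv/= lexx ler01.
  by have := IH [::]; rewrite /conic_sum big_nil; apply.
move=> /conic_cons[/= [a0 Cv] Cs] s1 sm; exists (conic_sum s, (a, v)).
  split; last by rewrite /= in_itv/= a0 (s1 (a, v)) ?mem_head.
  by apply: IH => // q qs; apply: s1; rewrite inE qs orbT.
by rewrite /conic_sum big_cons addrC.
Qed.

Variable u : vec.
Hypothesis Cu : forall x, C x -> dotp x u = 1.

Lemma dotp_conic_sum s : conic s -> dotp (conic_sum s) u = \sum_(q <- s) q.1.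
Proof.
move=> Cs; rewrite dotp_suml big_seq [RHS]big_seq; apply: eq_bigr => q qs.
by rewrite dotpZl Cu ?mulr1//; case: (Cs q qs).
Qed.

(** All of [C] has height [1] along [u], so the conical combinations of height [1] are exactly the
    convex ones. Their weights are at most [1], and [n] vectors suffice, so they form a closed slice
    of a compact truncated cone, from which a missing [x] is separated. *)
Lemma conic_separation x : compact C -> dotp x u = 1 ->
  (exists2 s, conic s & x = conic_sum s) \/
  (exists w c, (forall y, C y -> dotp y w <= c) /\ c < dotp x w).
Proof.
move=> cC xu; have [C0|/set0P C0] := eqVneq C set0.
  right; exists 0, (-1); split; first by move=> y; rewrite C0.
  by rewrite dotp0r ltrN10.
pose H : set vec := truncated_cone n `&` [set y | dotp y u = 1].
have HP y : H y <-> (exists2 s, conic s & y = conic_sum s) /\ dotp y u = 1.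
  split=> [[Ty yu]|[[s Cs ->] su]]; first by split => //; exact: truncated_cone_conic Ty.
  have [s' [Cs' s'E s'n]] := conic_caratheodory Cs.
  split=> //; rewrite -s'E; apply: conic_truncated_cone => // q qs'.
  move: su; rewrite -s'E dotp_conic_sum// => <-.
  rewrite (big_rem q)//= lerDl big_seq sumr_ge0// => q' /mem_rem/Cs'[].
  by [].
have [/HP[]|Hx] := pselect (H x); [by left|right].
have [|||w [c [wc cx]]] := @separation _ _ H x _ _ _ Hx.
- apply: compact_closedI; first exact: compact_truncated_cone.
  rewrite (_ : [set _ | _] = (fun y => dotp y u) @^-1` [set 1])//.
  apply: preimage_closed; last exact: closed_eq.
  by move=> y _; exact: dotpl_continuous.
- move=> y z t /HP[[s Cs sE] yu] /HP[[s' Cs' s'E] zu] /andP[t0 t1]; apply/HP; split.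
    exists ([seq ((1 - t) * q.1, q.2) | q <- s] ++ [seq (t * q.1, q.2) | q <- s']).
      move=> q; rewrite mem_cat => /orP[] /mapP[q' q's ->] /=.
        by have [? ?] := Cs q' q's; rewrite mulr_ge0 ?subr_ge0.
      by have [? ?] := Cs' q' q's; rewrite mulr_ge0.
    rewrite sE s'E /conic_sum big_cat !big_map/= !scaler_sumr.
    by congr (_ + _); apply: eq_bigr => q _; rewrite scalerA.
  by rewrite dotpDl !dotpZl yu zu; ring.
- have [v Cv] := C0; exists v; apply/HP; split; last exact: Cu.
  exists [:: (1, v)]; last by rewrite /conic_sum big_seq1 scale1r.
  by move=> q; rewrite inE => /eqP ->.
exists w, c; split => // y Cy; apply: wc; apply/HP; split; last exact: Cu.
exists [:: (1, y)]; last by rewrite /conic_sum big_seq1 scale1r.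
by move=> q; rewrite inE => /eqP ->.
Qed.

End Conic.

(** * Polar bodies, Cayley transform, determinants near the identity *)

Section Polar.
Variables (R : realType) (n : nat).
Implicit Types (S : set 'rV[R]_n.+1) (x p : 'rV[R]_n.+1).

(** A functional separating [x] from [S] is divided by a level [b] strictly between its bound on [S]
    and its value at [x]; [b] is positive because [S] contains [0]. The result lies in the polar and
    exceeds [1] at [x]. *)
Lemma bipolar S x : compact S -> Defs.convex_set S -> S 0 ->
  (forall p, polar S p -> dotp x p <= 1) -> S x.
Proof.
move=> cS convS S0 xS; apply: contrapT => Sx.
have [|w [c [wc cx]]] := separation cS convS _ Sx; first by exists 0.
have c0 : 0 <= c by have := wc _ S0; rewrite dotp0l.
pose b := (c + dotp x w) / 2.
have b0 : 0 < b by rewrite divr_gt0//; lra.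
have /xS : polar S (b^-1 *: w).
  move=> y /wc yc; rewrite dotpZr ler_pdivrMl// mulr1 /b; lra.
by rewrite dotpZr ler_pdivrMl// mulr1 /b; lra.
Qed.

(** If [x] were interior, some [(1 + t) *: x] with [t > 0] would still lie in [S] and pair with [p]
    to [1 + t]. *)
Lemma bd_of_dotp1 S x p : S x -> (forall y, S y -> dotp y p <= 1) ->
  dotp x p = 1 -> bd S x.
Proof.
move=> Sx Sp xp; split; first exact: subset_closure.
move=> /interior_box[e e0 eS].
pose t := e / (`|x| + 1).
have x0 : 0 < `|x| + 1 by rewrite ltr_wpDl.
have t0 : 0 < t by rewrite divr_gt0.
have tx : t * `|x| <= e.
  by rewrite /t mulrAC ler_pdivrMr// ler_pM2l// lerDl.
have /Sp : S ((1 + t) *: x).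
  apply: eS => i; have : `|t * x 0 i| <= e.
    rewrite normrM (gtr0_norm t0); apply: le_trans tx.
    by rewrite ler_pM2l// le_mx_norm.
  rewrite !mxE ler_norml; move: (t * x 0 i) (mulrDl 1 t (x 0 i)) => a ->; rewrite mul1r => ?.
  by lra.
by rewrite dotpZl xp mulr1; lra.
Qed.

(** A cube of half-side [e] inside [S], tested at the multiples [e] and [- e] of each basis vector,
    bounds every coordinate of [p] by [e^-1]; closedness holds because the polar is an intersection
    of half-spaces. *)
Lemma polar_compact S : interior S 0 -> compact (polar S).
Proof.
move=> /interior_box[e e0 eS]; apply: bounded_closed_compact.
  exists e^-1; split; first exact: num_real.
  move=> M /ltW eM p Sp; apply: le_trans eM.
  rewrite [leLHS]mx_normrE; apply: bigmax_le => [|[i j] _ /=]; first by rewrite invr_ge0 ltW.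
  rewrite ord1 -(ler_pM2l e0) mulfV ?gt_eqF// -ler_pdivlMl//.
  have delta s : `|s| <= e -> s * p 0 j <= 1.
    move=> se; have <- : dotp (s *: delta_mx 0 j) p = s * p 0 j.
      rewrite dotpZl dotpE (bigD1 j)//= big1 ?addr0 ?mxE ?eqxx ?mul1r// => k kj.
      by rewrite mxE (negPf kj) andbF mul0r.
    apply: Sp; apply: eS => k; rewrite !mxE eqxx; move: se; rewrite ler_norml.
    by case: (k == j) => /=; lra.
  have := delta e; have := delta (- e); rewrite normrN (gtr0_norm e0) lexx => /(_ isT) + /(_ isT).
  rewrite ler_pdivlMl//; case: (lerP 0 (p 0 j)) => pj; rewrite ?(ger0_norm pj) ?(ltr0_norm pj); lra.
rewrite (_ : polar S = \bigcap_(x in S) ((fun p => dotp p x) @^-1` [set a | a <= 1])); last first.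
  by apply/seteqP; split=> p Sp x Sx /=; [rewrite dotpC|rewrite dotpC]; exact: Sp.
apply: closed_bigI => x Sx; apply: preimage_closed; last exact: closed_le.
by move=> y _; exact: dotpl_continuous.
Qed.

End Polar.

Lemma dotp_mulmxl (R : realType) m n (x : 'rV[R]_m) (A : 'M[R]_(m, n)) (y : 'rV[R]_n) :
  dotp (x *m A) y = dotp x (y *m A^T).
Proof. by rewrite /dotp trmx_mul trmxK mulmxA. Qed.

Section Cayley.
Variables (R : realType) (n : nat).
Notation mx := 'M[R]_n.+1.

(** If [v = v *m U], skewness gives [dotp v v = - dotp v v]. *)
Lemma skew_unitmx (U : mx) : U^T = - U -> 1%:M - U \in unitmx.
Proof.
move=> skewU; rewrite -row_free_unit; apply: inj_row_free => v.
rewrite mulmxBr mulmx1 => /eqP; rewrite subr_eq0 => /eqP vU.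
apply: dotp_eq0; have := dotp_mulmxl v U v.
by rewrite skewU mulmxN -vU dotpNr; lra.
Qed.

(** [Q] is [(1 + U) (1 - U)^-1], orthogonal because transposition swaps the two commuting factors.
    Substituting [Q = 1 + U + Q U] into itself gives an exact second-order expansion. *)
Lemma cayley (U : mx) : U^T = - U ->
  exists2 Q, orthogonal_mx Q & Q = 1%:M + 2 *: U + (Q + 1%:M) *m U *m U.
Proof.
move=> skewU; have uV := skew_unitmx skewU.
pose Q := (1%:M + U) *m invmx (1%:M - U).
have QV : Q *m (1%:M - U) = 1%:M + U by rewrite mulmxKV.
have VW : (1%:M - U) *m (1%:M + U) = (1%:M + U) *m (1%:M - U).
  rewrite !mulmxDl !mulmxDr !mul1mx !mulmx1 mulmxN mulNmx.
  by move: (U *m U) => UU; apply/matrixP => i j; rewrite !mxE; ring.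
have trV : (1%:M - U)^T = 1%:M + U by rewrite linearB/= skewU trmx1 opprK.
have trW : (1%:M + U)^T = 1%:M - U by rewrite linearD/= skewU trmx1.
exists Q.
  apply: mulmx1C; apply: (can_inj (mulmxK uV)); apply: trmx_inj.
  apply: (can_inj (mulmxK uV)); rewrite !mul1mx.
  by rewrite -mulmxA QV trmx_mul trmxK trW -mulmxA QV trV VW.
have QU : Q *m U = Q - (1%:M + U).
  by rewrite -QV mulmxBr mulmx1 subKr.
rewrite !mulmxDl !mul1mx QU !mulmxBl !mulmxDl !mul1mx QU scaler_nat mulr2n.
by apply/matrixP => i j; rewrite !mxE; ring.
Qed.

End Cayley.

Lemma horner_char_poly (R : comNzRingType) n (A : 'M[R]_n) x : (char_poly A).[x] = \det (x%:M - A).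
Proof.
rewrite -[LHS]/(horner_eval x _) /char_poly -det_map_mx; congr (\det _).
by apply/matrixP => i j; rewrite !mxE /= /horner_eval !(hornerE, hornerMn).
Qed.

(** The determinant is [e ^+ n.+1] times the characteristic polynomial of [- H] at [e^-1]. Its two
    top coefficients contribute [1 + e * \tr H], and the others at most [e ^+ 2 * B]. *)
Lemma det_1addZ_gt1 (R : realType) n (H : 'M[R]_n.+1) : 0 < \tr H ->
  exists2 e0 : R, 0 < e0 & forall e : R, 0 < e < e0 -> 1 < \det (1%:M + e *: H).
Proof.
move=> trH; pose chi := char_poly (- H).
pose B : R := \sum_(k < n) `|chi`_k|.
have B0 : 0 <= B by exact: sumr_ge0.
exists (Num.min 1 (\tr H / (B + 1))).
  by rewrite lt_min ltr01 divr_gt0// ltr_wpDl.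
move=> e; rewrite lt_min => /andP[e0 /andP[e1]].
rewrite ltr_pdivlMr ?ltr_wpDl// => eB.
have ne0 : e != 0 by rewrite gt_eqF.
have -> : 1%:M + e *: H = e *: (e^-1%:M - - H).
  by rewrite opprK scalerDr scale_scalar_mx mulfV.
rewrite detZ -horner_char_poly horner_coef size_char_poly mulr_sumr !big_ord_recr/=.
have -> : (char_poly (- H))`_n = \tr H.
  by have := @char_poly_trace _ n.+1 (- H) isT; rewrite /= linearN/= opprK.
have -> : (char_poly (- H))`_n.+1 = 1.
  have /monicP := char_poly_monic (- H).
  by rewrite lead_coefE size_char_poly.
have -> : e ^+ n.+1 * (\tr H * e^-1 ^+ n) = e * \tr H.
  by rewrite exprS exprVn; field; rewrite expf_neq0.
have -> : e ^+ n.+1 * (1 * e^-1 ^+ n.+1) = 1.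
  by rewrite mul1r -exprMn mulfV// expr1n.
set s := \sum_(_ < _) _.
have : `|s| <= e ^+ 2 * B.
  rewrite mulr_sumr; apply: le_trans (ler_norm_sum _ _ _) _; apply: ler_sum => k _.
  rewrite normrM normrM [`|_`_k| * _]mulrC mulrA; apply: ler_wpM2r => //.
  rewrite -normrM exprVn -expfB; last by rewrite ltnS ltnW.
  rewrite ger0_norm; last by rewrite exprn_ge0// ltW.
  apply: ler_wiXn2l; [exact: ltW|exact: ltW|by rewrite ltn_subRL addn1 ltnS].
rewrite ler_norml => /andP[sB _].
have : 0 < e * (\tr H - e * B).
  rewrite mulr_gt0// subr_gt0; apply: le_lt_trans eB.
  by rewrite mulrDr lerDl mulr1 ltW.
by lra.
Qed.

(** * First-order perturbations *)

Section MatrixCvg.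
Variables (R : realType) (T : Type) (Fl : set_system T).
Context {FF : Filter Fl}.

Lemma cvg_mx m n (f : T -> 'M[R]_(m, n)) (A : 'M[R]_(m, n)) :
  (forall i j, f t i j @[t --> Fl] --> A i j) -> f @ Fl --> A.
Proof.
move=> fA; rewrite [A]matrix_sum_delta.
rewrite (_ : f = fun t => \sum_i \sum_j f t i j *: delta_mx i j); last first.
  by apply/funext => t; exact: matrix_sum_delta.
apply: (@cvg_big 'M[R]_(m, n) _ _ _ _ add_continuous) => i _.
apply: (@cvg_big 'M[R]_(m, n) _ _ _ _ add_continuous) => j _.
by apply: cvgZ; [exact: fA|exact: cvg_cst].
Qed.

Lemma cvg_mx_coord m n (f : T -> 'M[R]_(m, n)) (A : 'M[R]_(m, n)) i j :
  f @ Fl --> A -> f t i j @[t --> Fl] --> A i j.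
Proof.
by move=> fA; apply: (cvg_comp f (fun z : 'M[R]_(m, n) => z i j) fA); exact: coord_continuous.
Qed.

Lemma cvg_mulmx m n k (f : T -> 'M[R]_(m, n)) (g : T -> 'M[R]_(n, k))
    (A : 'M[R]_(m, n)) (B : 'M[R]_(n, k)) :
  f @ Fl --> A -> g @ Fl --> B -> f t *m g t @[t --> Fl] --> A *m B.
Proof.
move=> fA gB; apply: cvg_mx => i j; rewrite mxE.
rewrite (_ : (fun t => _) = fun t => \sum_l f t i l * g t l j); last first.
  by apply/funext => t; rewrite mxE.
apply: (@cvg_big R _ _ _ _ add_continuous _ _ _ (fun l t => f t i l * g t l j)) => l _.
by apply: cvgM; exact: cvg_mx_coord.
Qed.

Lemma cvg_trmx m n (f : T -> 'M[R]_(m, n)) (A : 'M[R]_(m, n)) :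
  f @ Fl --> A -> (f t)^T @[t --> Fl] --> A^T.
Proof.
move=> fA; apply: cvg_mx => i j; rewrite mxE.
rewrite (_ : (fun t => _) = fun t => f t j i); first exact: cvg_mx_coord.
by apply/funext => t; rewrite mxE.
Qed.

Lemma cvg_mxvec m n (f : T -> 'M[R]_(m, n)) (A : 'M[R]_(m, n)) :
  f @ Fl --> A -> mxvec (f t) @[t --> Fl] --> mxvec A.
Proof.
move=> fA; apply: cvg_mx => i k; rewrite ord1; case/mxvec_indexP: k => k l.
rewrite mxvecE (_ : (fun t => _) = fun t => f t k l); first exact: cvg_mx_coord.
by apply/funext => t; rewrite mxvecE.
Qed.

Lemma cvg_row_mx m n k (f : T -> 'M[R]_(m, n)) (g : T -> 'M[R]_(m, k))
    (A : 'M[R]_(m, n)) (B : 'M[R]_(m, k)) :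
  f @ Fl --> A -> g @ Fl --> B -> row_mx (f t) (g t) @[t --> Fl] --> row_mx A B.
Proof.
move=> fA gB; apply: cvg_mx => i j; case: (split_ordP j) => l ->.
  rewrite row_mxEl (_ : (fun t => _) = fun t => f t i l); first exact: cvg_mx_coord.
  by apply/funext => t; rewrite row_mxEl.
rewrite row_mxEr (_ : (fun t => _) = fun t => g t i l); first exact: cvg_mx_coord.
by apply/funext => t; rewrite row_mxEr.
Qed.

End MatrixCvg.

(** Near a point with [g = 1] the negative [h] dominates the quadratic term; near any other point
    the gap [1 - g] absorbs both corrections. Compactness makes the range of [e] uniform. *)
Lemma first_order_perturbation (R : realType) (T : topologicalType) (A : set T)
    (g h : T -> R) (B : R) : compact A -> continuous g -> continuous h ->
  (forall x, A x -> g x <= 1) -> (forall x, A x -> g x = 1 -> h x < 0) ->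
  \forall e \near 0^'+, forall x, A x -> g x + e * h x + e ^+ 2 * B <= 1.
Proof.
move=> cA cg ch gA hA.
have near_cover : forall x, A x -> \forall x' \near x & e \near (0 : R)^'+,
    A x' -> g x' + e * h x' + e ^+ 2 * B <= 1.
  move=> x Ax; have [gx|gx] := eqVneq (g x) 1.
    pose c := - h x / 2; have c0 : 0 < c by have := hA x Ax gx; rewrite /c; lra.
    pose b := c / (`|B| + 1).
    have b0 : 0 < b by rewrite divr_gt0// ltr_wpDl.
    exists ([set y | h y < - c], [set e : R | 0 < e < b]).
      split => /=.
        by apply: (cvgr_lt _ (ch x)); rewrite /c; have := hA x Ax gx; lra.
      near=> e; apply/andP; split; near: e; first exact: nbhs_right_gt.
      exact: nbhs_right_lt.
    move=> [y e] [/= hy /andP[e0]]; rewrite ltr_pdivlMr ?ltr_wpDl// => eB Ay.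
    have gy := gA y Ay; have BB := ler_norm B.
    have : e * (e * B + h y) <= 0; last by lra.
    rewrite pmulr_rle0//; have : e * B <= e * `|B| by rewrite ler_pM2l.
    by lra.
  pose mu := (1 - g x) / 2; pose c := `|h x| + 1.
  have gx1 : g x < 1 by rewrite lt_neqAle gx gA.
  have mu0 : 0 < mu by rewrite divr_gt0// subr_gt0.
  have c0 : 0 < c by rewrite ltr_wpDl.
  pose b := mu / (c + `|B|); have cB : 0 < c + `|B| by rewrite ltr_pwDl.
  have b0 : 0 < b by rewrite divr_gt0.
  exists ([set y | g y < 1 - mu] `&` [set y | h y < c],
          [set e : R | [&& 0 < e, e < 1 & e < b]]).
    split => /=.
      apply: filterI; first by apply: (cvgr_lt _ (cg x)); rewrite /mu; lra.
      by apply: (cvgr_lt _ (ch x)); rewrite /c (le_lt_trans (ler_norm _))// ltrDl.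
    near=> e; apply/and3P; split; near: e; [exact: nbhs_right_gt|exact: nbhs_right_lt|].
    exact: nbhs_right_lt.
  move=> [y e] [/= [gy hy] /and3P[e0 e1]]; rewrite ltr_pdivlMr// => eb Ay.
  have BB := ler_norm B.
  have : e * h y <= e * c by rewrite ler_pM2l// ltW.
  have : e ^+ 2 * B <= e * `|B|.
    rewrite expr2 -mulrA ler_pM2l//; have [B0|/ltW B0] := leP 0 B.
      by rewrite ger0_norm// ler_piMl// ltW.
    by apply: le_trans (normr_ge0 B); rewrite mulr_ge0_le0// ltW.
  by lra.
have : \forall e \near (0 : R)^'+,
    A `<=` (fun x => A x -> g x + e * h x + e ^+ 2 * B <= 1).
  exact: (proj1 (compact_near_coveringP A) cA _ _
    (fun e x => A x -> g x + e * h x + e ^+ 2 * B <= 1)).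
by apply: filterS => e Ae x Ax; exact: (Ae x Ax Ax).
Unshelve. all: by end_near. Qed.

(** * Orthogonal projection onto [F], and norm estimates *)

Section Projection.
Variables (R : realType) (n : nat) (F : 'M[R]_n).
Let B := row_base F.

Lemma gram_unitmx m k (A : 'M[R]_(m, k)) : row_free A -> A *m A^T \in unitmx.
Proof.
move=> freeA; rewrite -row_free_unit; apply: inj_row_free => v vA.
have vA0 : v *m A = 0.
  by apply: dotp_eq0; rewrite /dotp trmx_mul mulmxA -(mulmxA v) vA mul0mx mxE.
by apply: (row_free_inj freeA); rewrite vA0 mul0mx.
Qed.

Let G_unit : B *m B^T \in unitmx.
Proof. exact/gram_unitmx/row_base_free. Qed.

Lemma trmx_projF : (projF F)^T = projF F.
Proof.
rewrite /projF; move: (row_base F) => C.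
by rewrite !trmx_mul trmxK trmx_inv trmx_mul trmxK mulmxA.
Qed.

Lemma projF_idem : projF F *m projF F = projF F.
Proof.
move: G_unit; rewrite /projF -/B; move: B => C uC.
by rewrite -!mulmxA (mulmxA C) (mulmxA (invmx _)) mulVmx// mul1mx.
Qed.

Lemma projF_sub : (projF F <= F)%MS.
Proof. by rewrite -(eq_row_base F); exact: submxMl. Qed.

Lemma perp_projF k (x : 'M[R]_(k, n)) : (x <= perp F)%MS -> x *m projF F = 0.
Proof.
move/sub_kermxP => xF.
have : (B <= F)%MS by rewrite eq_row_base.
rewrite /projF -/B; move: B => C /submxP[X CX].
by rewrite {1}CX trmx_mul !mulmxA xF !mul0mx.
Qed.

End Projection.

Section NormBounds.
Variable R : realType.

Lemma norm_mulmx_le m n k (A : 'M[R]_(m, n)) (B : 'M[R]_(n, k)) :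
  `|A *m B| <= n%:R * (`|A| * `|B|).
Proof.
rewrite [leLHS]mx_normrE; apply: bigmax_le => [|[i j] _ /=].
  by rewrite !mulr_ge0.
rewrite mxE; apply: le_trans (ler_norm_sum _ _ _) _.
rewrite [leRHS](_ : _ = \sum_(l < n) `|A| * `|B|); last first.
  by rewrite sumr_const card_ord mulr_natl.
by apply: ler_sum => l _; rewrite normrM ler_pM// le_mx_norm.
Qed.

Lemma norm_dotp_le n (x y : 'rV[R]_n) : `|dotp x y| <= n%:R * (`|x| * `|y|).
Proof.
rewrite dotpE; apply: le_trans (ler_norm_sum _ _ _) _.
rewrite [leRHS](_ : _ = \sum_(l < n) `|x| * `|y|); last first.
  by rewrite sumr_const card_ord mulr_natl.
by apply: ler_sum => l _; rewrite normrM ler_pM// le_mx_norm.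
Qed.

(** The matrix norm is the largest absolute entry, and the rows of [Q] have Euclidean length one. *)
Lemma norm_orthogonal_le n (Q : 'M[R]_n) : orthogonal_mx Q -> `|Q| <= 1.
Proof.
move=> QQ; rewrite [leLHS]mx_normrE; apply: bigmax_le => [|[i j] _ /=]; first exact: ler01.
have := congr1 (fun M : 'M[R]_n => M i i) QQ; rewrite !mxE eqxx (bigD1 j)//= mxE => QQi.
have : 0 <= \sum_(k < n | k != j) Q i k * Q^T k i.
  by apply: sumr_ge0 => k _; rewrite mxE -expr2 sqr_ge0.
move=> s0; rewrite -(@ler_pXn2r _ 2) ?nnegrE//.
by rewrite expr1n -normrX ger0_norm ?sqr_ge0// expr2; move: QQi s0; rewrite mulr1n; lra.
Qed.

End NormBounds.

Section Perturbation.
Variables (R : realType) (n : nat).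
Notation vec := 'rV[R]_n.+1.
Notation mx := 'M[R]_n.+1.

(** The remainder [E] is bounded uniformly in [e], since it depends on [e] only through [1 + e *: H]
    with [e < 1] and through the orthogonal [Q], whose entries are at most [1]. *)
Lemma cayley_first_order (H S : mx) : S^T = - S ->
  exists2 b : R, 0 <= b & forall e : R, 0 < e < 1 -> exists Q E : mx,
    [/\ orthogonal_mx Q, (1%:M + e *: H) *m Q = 1%:M + e *: (H + S) + e ^+ 2 *: E &
        `|E| <= b].
Proof.
move=> skewS; set N : R := n.+1%:R.
pose b : R := N * (`|H| * `|S|) +
  4^-1 * (N * (N * ((`|1%:M : mx| + `|H|) * (1 + `|1%:M : mx|)) * `|S *m S|)).
exists b; first by rewrite !(addr_ge0, mulr_ge0).
move=> e /andP[e0 e1].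
(* The Cayley transform of [U] has first-order term [2 *: U], hence the half. *)
have [|Q orthQ QE] := @cayley _ _ ((e / 2) *: S).
  by rewrite linearZ/= skewS scalerN.
pose E := H *m S + 4^-1 *: (((1%:M + e *: H) *m (Q + 1%:M)) *m (S *m S)).
have QS : Q = 1%:M + e *: S + (e ^+ 2 / 4) *: ((Q + 1%:M) *m (S *m S)).
  rewrite {1}QE scalerA -!scalemxAr -!scalemxAl scalerA mulmxA; congr (_ + _ *: _ + _ *: _).
    by field.
  by field.
exists Q, E; split => //.
  rewrite {1}QS mulmxDr -scalemxAr mulmxDr mulmx1 -scalemxAr mulmxDl mul1mx -scalemxAl.
  rewrite /E -[_ *m (Q + 1%:M) *m _]mulmxA.
  move: (_ *m ((Q + 1%:M) *m _)) (H *m S) => X Y.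
  by apply/matrixP => i j; rewrite !mxE; field.
have HS : `|H *m S| <= N * (`|H| * `|S|) by exact: norm_mulmx_le.
have A1 : `|(1%:M : mx) + e *: H| <= `|1%:M : mx| + `|H|.
  apply: le_trans (ler_normD _ _) _; rewrite lerD2l normrZ gtr0_norm//.
  by rewrite ler_piMl// ltW.
have Q1 : `|Q + 1%:M| <= 1 + `|1%:M : mx|.
  by apply: le_trans (ler_normD _ _) _; rewrite lerD2r norm_orthogonal_le.
apply: le_trans (ler_normD _ _) _; rewrite lerD// normrZ ger0_norm// ler_wpM2l//.
apply: le_trans (norm_mulmx_le _ _) _; rewrite ler_wpM2l//.
rewrite ler_wpM2r//; apply: le_trans (norm_mulmx_le _ _) _.
by rewrite ler_wpM2l// ler_pM.
Qed.

Lemma det_orthogonal (Q : mx) : orthogonal_mx Q -> `|\det Q| = 1.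
Proof.
move=> /(congr1 (fun M : mx => \det M)); rewrite det_mulmx det_tr det1 -expr2 => Q2.
by apply/eqP; rewrite -(@pexpr_eq1 _ _ 2)// -normrX Q2 normr1.
Qed.

(** The compressed matrix has its image in [F] and kills the orthogonal complement, where [A]
    therefore acts as the scalar [1 - e * k]. *)
Lemma F_operator_perturbation (F Y : mx) (k e : R) :
  let A := 1%:M + e *: (projF F *m Y *m projF F - k%:M) in
  A \in unitmx -> 1 - e * k != 0 -> F_operator F A.
Proof.
move=> A uA ck.
have perpA m (x : 'M[R]_(m, n.+1)) : (x <= perp F)%MS -> x *m A = (1 - e * k) *: x.
  move=> /perp_projF xP; rewrite /A mulmxDr mulmx1 -scalemxAr mulmxBr.
  rewrite -(mulmxA (projF F)) (mulmxA x) xP mul0mx.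
  by rewrite sub0r mul_mx_scalar scalerN scalerA scalerBl scale1r.
split => //; split; last first.
  split; first by rewrite perpA// scalemx_sub.
  by exists (1 - e * k); split => // x; exact: perpA.
rewrite /A mulmxDr mulmx1 addmx_sub// -scalemxAr scalemx_sub// mulmxBr addmx_sub//.
  by rewrite mulmxA (submx_trans (submxMl _ _))// projF_sub.
by rewrite mul_mx_scalar -scaleN1r !scalemx_sub.
Qed.

Lemma no_improving_direction (K L : set vec) (F Y S : mx) (z : vec) (k : R) :
  convex_body K -> convex_body L -> interior L 0 -> K `<=` L ->
  (forall K', rotated_positions F K K' -> K' `<=` L ->
     (volume K' <= volume K)%E) ->
  S^T = - S ->
  let H := projF F *m Y *m projF F - k%:M in
  0 < \tr H ->
  ~ (forall v p, K v -> polar L p -> dotp v p = 1 -> dotp (v *m (H + S) + z) p < 0).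
Proof.
move=> [convK [cK K0]] [convL [cL _]] L0 KL maxK skewS H trH neg.
have L00 : L 0 by exact: interior_subset.
have cP := polar_compact L0.
have [b b0 rot] := cayley_first_order H skewS.
have [a a0 Ka] := compact_norm_le cK; have [c c0 Pc] := compact_norm_le cP.
(* [B] bounds [dotp (x *m E) p] for [x] in [K] and [p] in the polar of [L], and so controls the
   second-order remainder. *)
set N : R := n.+1%:R; pose B : R := N * (N * (a * b) * c).
pose g (q : vec * vec) := dotp q.1 q.2.
pose h (q : vec * vec) := dotp (q.1 *m (H + S) + z) q.2.
have cg : continuous g by move=> q; apply: cvg_dotp; [exact: cvg_fst|exact: cvg_snd].
have ch : continuous h.
  move=> q; apply: cvg_dotp; last exact: cvg_snd.
  by apply: cvgD; [apply: cvg_mulmx; [exact: cvg_fst|exact: cvg_cst]|exact: cvg_cst].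
have pert := @first_order_perturbation _ _ (K `*` polar L) g h B (compact_setX cK cP) cg ch.
have {}pert : \forall e \near (0 : R)^'+, forall x, (K `*` polar L) x ->
    g x + e * h x + e ^+ 2 * B <= 1.
  apply: pert => [[x p] [/= Kx Lp]|[x p] [/= Kx Lp]]; first by apply: Lp; exact: KL.
  exact: neg.
have [e0 e0gt det_gt1] := det_1addZ_gt1 trH.
have k1 : 0 < `|k| + 1 by rewrite ltr_wpDl.
(* The last condition forces [|e * k| < 1], so that the scalar on the orthogonal complement of [F]
   is nonzero. *)
have [e [/= pert_e [e_gt0 [elt1 [ee0 ek]]]]] : exists e : R,
    (forall x, (K `*` polar L) x -> g x + e * h x + e ^+ 2 * B <= 1) /\
    0 < e /\ e < 1 /\ e < e0 /\ e < (`|k| + 1)^-1.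
  apply: (@filter_ex _ (0 : R)^'+); do ![apply: filterI]; first exact: pert.
  - exact: nbhs_right_gt.
  - exact: nbhs_right_lt.
  - exact: nbhs_right_lt.
  - by apply: nbhs_right_lt; rewrite invr_gt0.
have detA : 1 < \det (1%:M + e *: H) by apply: det_gt1; rewrite e_gt0.
have [|Q [E [orthQ AQ Eb]]] := rot e; first by rewrite e_gt0.
have Fop : F_operator F (1%:M + e *: H).
  apply: F_operator_perturbation; first by rewrite unitmxE unitfE gt_eqF// (lt_trans _ detA).
  have : `|e * k| < 1.
    rewrite normrM (gtr0_norm e_gt0); move: ek; rewrite -[_^-1]mul1r ltr_pdivlMr// => ek.
    by apply: le_lt_trans ek; rewrite ler_wpM2l ?(ltW e_gt0)// lerDl.
  by apply: contraTneq => /subr0_eq <-; rewrite normr1 ltxx.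
have /maxK : rotated_positions F K [set x *m (1%:M + e *: H) *m Q + e *: z | x in K].
  by exists Q, (1%:M + e *: H), (e *: z).
apply/not_implyP; split.
  (* By the bipolar theorem, inclusion in [L] amounts to the perturbed inequality for every [p] in
     the polar of [L]. *)
  move=> _ [x Kx <-]; apply: bipolar => // p Lp; rewrite -mulmxA AQ.
  apply: le_trans (pert_e (x, p) (conj Kx Lp)); rewrite /g /h /=.
  rewrite !(mulmxDr, mulmx1, dotpDl) -!scalemxAr !dotpZl !mulmxDr !dotpDl.
  have : dotp (x *m E) p <= B.
    apply: le_trans (ler_norm _) _; apply: le_trans (norm_dotp_le _ _) _.
    rewrite ler_wpM2l// ler_pM//; last exact: Pc.
    apply: le_trans (norm_mulmx_le _ _) _; rewrite ler_wpM2l// ler_pM//.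
    exact: Ka.
  move=> /(ler_wpM2l (sqr_ge0 e)); lra.
apply/negP; rewrite -ltNge.
have -> : [set x *m (1%:M + e *: H) *m Q + e *: z | x in K] =
    [set x *m ((1%:M + e *: H) *m Q) + e *: z | x in K].
  by apply: eq_imagel => x _; rewrite mulmxA.
apply: volume_affine_gt => //.
by rewrite det_mulmx normrM (det_orthogonal orthQ) mulr1 (lt_le_trans detA)// ler_norm.
Qed.

End Perturbation.

(** * The space of first-order variations *)

Lemma dotp_row_mx (R : realType) m k (a b : 'rV[R]_m) (c e : 'rV[R]_k) :
  dotp (row_mx a c) (row_mx b e) = dotp a b + dotp c e.
Proof. by rewrite /dotp tr_row_mx mul_row_col mxE. Qed.

Lemma dotp_mxvec (R : realType) m k (A B : 'M[R]_(m, k)) :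
  dotp (mxvec A) (mxvec B) = \tr (A *m B^T).
Proof.
rewrite dotpE /mxtrace; under [RHS]eq_bigr do rewrite mxE.
rewrite pair_bigA (reindex _ (curry_mxvec_bij _ _))/=.
by apply: eq_bigr => -[i j] _ /=; rewrite !mxvecE mxE.
Qed.

Section Embedding.
Variables (R : realType) (n : nat).
Notation vec := 'rV[R]_n.+1.
Notation mx := 'M[R]_n.+1.
Variable P : mx.

Lemma trmx_tensor (p v : vec) : (tensor p v)^T = tensor v p.
Proof. by rewrite /tensor trmx_mul trmxK. Qed.

Lemma mxtrace_tensor (p v : vec) : \tr (tensor p v) = dotp p v.
Proof. by rewrite /tensor mxtrace_mulC trace_mx11. Qed.

Lemma dotp_mxvec_tensor (p v : vec) (M : mx) :
  dotp (mxvec (tensor p v)) (mxvec M) = dotp (v *m M) p.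
Proof.
rewrite dotp_mxvec /tensor -mulmxA mxtrace_mulC trace_mx11 -/(dotp _ _).
by rewrite dotp_mulmxl trmxK dotpC.
Qed.

(* The first block records the [F]-operators, the second one the rotations, the
   third one the translations; the constant coordinate turns convex combinations
   into conical ones. *)
Definition john_embedding (p v : vec) : 'rV[R]_(n.+1 * n.+1 + (n.+1 * n.+1 + (n.+1 + 1))) :=
  let T := tensor p v in
  row_mx (mxvec (P *m T *m P)) (row_mx (mxvec (T - T^T)) (row_mx p 1%:M)).

(** The projection is divided by the dimension because the weights first sum to one; they are
    rescaled at the end. *)
Definition john_target : 'rV[R]_(n.+1 * n.+1 + (n.+1 * n.+1 + (n.+1 + 1))) :=
  row_mx (mxvec (n.+1%:R^-1 *: P)) (row_mx (mxvec 0) (row_mx 0 1%:M)).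

Definition john_height : 'rV[R]_(n.+1 * n.+1 + (n.+1 * n.+1 + (n.+1 + 1))) :=
  row_mx 0 (row_mx 0 (row_mx 0 1%:M)).

Lemma dotp11 : dotp (1%:M : 'rV[R]_1) 1%:M = 1.
Proof. by rewrite /dotp trmx1 mulmx1 mxE. Qed.

Lemma john_embedding_height p v : dotp (john_embedding p v) john_height = 1.
Proof. by rewrite !dotp_row_mx !dotp0r dotp11 !add0r. Qed.

Lemma john_target_height : dotp john_target john_height = 1.
Proof. by rewrite !dotp_row_mx !dotp0r dotp11 !add0r. Qed.

Lemma john_embedding_continuous : continuous (fun q : vec * vec => john_embedding q.2 q.1).
Proof.
move=> q; have cT : tensor q.2 q.1 @[q --> q] --> tensor q.2 q.1.
  by apply: cvg_mulmx; [apply: cvg_trmx; exact: cvg_fst|exact: cvg_snd].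
apply: cvg_row_mx.
  apply: cvg_mxvec; apply: cvg_mulmx; last exact: cvg_cst.
  by apply: cvg_mulmx => //; exact: cvg_cst.
apply: cvg_row_mx.
  by apply: cvg_mxvec; apply: cvgB => //; exact: cvg_trmx.
by apply: cvg_row_mx; [exact: cvg_snd|exact: cvg_cst].
Qed.

(* A linear functional on the ambient space, evaluated on the embedded pairs, is
   the first-order variation along an [F]-operator, a rotation and a translation. *)
Lemma john_embedding_functional w : P^T = P ->
  exists (Y S : mx) (z : vec) (c : R), S^T = - S /\
    (forall p v, dotp (john_embedding p v) w
       = dotp (v *m (P *m Y *m P + S) + z) p + c) /\
    dotp john_target w = n.+1%:R^-1 * \tr (P *m Y) + c.
Proof.
move=> symP; rewrite -[w]hsubmxK -[rsubmx w]hsubmxK -[rsubmx (rsubmx w)]hsubmxK.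
set w1 := lsubmx w; set w2 := lsubmx (rsubmx w).
set z := lsubmx (rsubmx (rsubmx w)); set c := rsubmx (rsubmx (rsubmx w)).
rewrite -[w1]vec_mxK -[w2]vec_mxK; move: (vec_mx w1) (vec_mx w2) => Y Z.
(* Pairing [Z] with the antisymmetric block [T - T^T] is pairing [T] with the skew matrix
   [Z - Z^T]. *)
exists Y, (Z - Z^T), z, (dotp 1%:M c); split.
  by rewrite linearB/= trmxK opprB.
split => [p v|]; rewrite !dotp_row_mx; last first.
  rewrite linear0 !dotp0l !add0r linearZ/= dotpZl dotp_mxvec; congr (_ * _ + _).
  by rewrite -mxtrace_tr trmx_mul trmxK symP mxtrace_mulC.
rewrite addrA addrA; congr (_ + _); rewrite dotpDl [dotp z p]dotpC; congr (_ + _).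
rewrite mulmxDr dotpDl; congr (_ + _).
  have -> : P *m tensor p v *m P = tensor (p *m P) (v *m P).
    by rewrite /tensor trmx_mul symP !mulmxA.
  by rewrite dotp_mxvec_tensor mulmxA [RHS]dotp_mulmxl symP mulmxA.
rewrite linearB/= trmx_tensor dotpDl dotpNl !dotp_mxvec_tensor mulmxBr dotpDl dotpNl.
by congr (_ - _); rewrite dotp_mulmxl dotpC.
Qed.

End Embedding.

(** * Contact pairs and the decomposition *)

(** Each of [v] and [p] serves as a supporting functional at the other; [K] inside [L] reverses to
    an inclusion of polars, which places both points in all four sets. *)
Lemma contact_pair_of_dotp1 (R : realType) n (K L : set 'rV[R]_n.+1) (v p : 'rV[R]_n.+1) :
  K `<=` L -> K v -> polar L p -> dotp v p = 1 -> contact_pair K L v p.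
Proof.
move=> KL Kv Lp vp; have Kp : polar K p by move=> x /KL; exact: Lp.
have pv : dotp p v = 1 by rewrite dotpC.
split; first exact: (bd_of_dotp1 Kv Kp vp).
split; first exact: (bd_of_dotp1 (KL _ Kv) Lp vp).
split; first by apply: (bd_of_dotp1 Kp _ pv) => q Kq; rewrite dotpC; exact: Kq.
by split=> //; apply: (bd_of_dotp1 Lp _ pv) => q Lq; rewrite dotpC; apply/Lq/KL.
Qed.

Lemma john_target_in_cone (R : realType) (n : nat) (K L : set 'rV[R]_n.+1)
    (F : 'M[R]_n.+1) :
  convex_body K -> convex_body L -> interior L 0 -> K `<=` L ->
  (forall K', rotated_positions F K K' -> K' `<=` L ->
     (volume K' <= volume K)%E) ->
  exists2 s : seq (R * 'rV[R]_(n.+1 * n.+1 + (n.+1 * n.+1 + (n.+1 + 1)))),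
    conic [set john_embedding (projF F) q.2 q.1 | q in
      (K `*` polar L) `&` [set q | dotp q.1 q.2 = 1]] s &
    john_target (projF F) = conic_sum s.
Proof.
move=> bK bL L0 KL maxK; set C := (X in conic X).
have cC : compact C.
  apply: continuous_compact.
    exact/continuous_subspaceT/john_embedding_continuous.
  apply: compact_closedI.
    by apply: compact_setX; [case: bK => _ []|exact: polar_compact].
  rewrite (_ : [set _ | _] = (fun q => dotp q.1 q.2) @^-1` [set 1])//.
  apply: preimage_closed; last exact: closed_eq.
  by move=> q _; apply: cvg_dotp; [exact: cvg_fst|exact: cvg_snd].
have [x [q _ <-]||//|[w [c [wC cw]]]] := @conic_separation _ _ C (john_height R n) _
    (john_target (projF F)) cC.
- exact: john_embedding_height.
- exact: john_target_height.
have [Y [S [z [c0 [skewS [wE wt]]]]]] := john_embedding_functional w (trmx_projF F).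
exfalso; set t := \tr (projF F *m Y) in wt.
(* Separation reads [c - c0 < r], and [k] is the midpoint. Subtracting [k] makes the variation
   negative on contact pairs, where it was at most [c - c0], and leaves the trace [n.+1 * (r - k)]
   positive. *)
set r := n.+1%:R^-1 * t in wt; pose k := (c - c0 + r) / 2.
have n0 : 0 < n.+1%:R :> R by rewrite ltr0n.
have kt : n.+1%:R * k < t.
  by rewrite -ltr_pdivlMl// -/r /k; move: cw; rewrite wt; lra.
have tPYP : \tr (projF F *m Y *m projF F) = t.
  by rewrite mxtrace_mulC mulmxA projF_idem.
apply: (@no_improving_direction _ _ K L F Y S z k) => //.
  by rewrite linearB/= tPYP mxtrace_scalar subr_gt0 -mulr_natl.
move=> v p Kv Lp vp; have := wC (john_embedding (projF F) p v).
have Cvp : C (john_embedding (projF F) p v) by exists (v, p).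
move=> /(_ Cvp); rewrite wE.
have -> : v *m (projF F *m Y *m projF F - k%:M + S) + z =
    (v *m (projF F *m Y *m projF F + S) + z) - k *: v.
  by rewrite -mul_mx_scalar addrAC mulmxBr addrAC.
move: (_ + z) => u; rewrite dotpDl dotpNl dotpZl vp mulr1 /k; move: cw; rewrite wt; lra.
Qed.

Theorem mainTheorem3 (R : realType) (d : nat) (K L : set 'rV[R]_d)
  (F : 'M[R]_d) :
  convex_body K -> convex_body L ->
  interior K 0 -> interior L 0 ->
  K `<=` L ->
  (forall K', rotated_positions F K K' -> K' `<=` L ->
     (volume K' <= volume K)%E) ->
  exists (m : nat) (v p : 'I_m -> 'rV[R]_d) (alpha : 'I_m -> R),
    (forall i, contact_pair K L (v i) (p i) /\ 0 < alpha i) /\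
    let T := \sum_(i < m) alpha i *: tensor (p i) (v i) in
    projF F *m T *m projF F = projF F /\
    \sum_(i < m) alpha i *: p i = 0 /\
    \tr T = (d%:R : R) /\
    \sum_(i < m) alpha i = (d%:R : R) /\
    T = \sum_(i < m) alpha i *: tensor (v i) (p i).
Proof.
case: d K L F => [|n] K L F bK bL K0 L0 KL maxK.
  (* In dimension zero the empty family satisfies every identity. *)
  exists 0%N, (fun=> 0), (fun=> 0), (fun=> 0); split; first by case.
  by rewrite /= /mxtrace !big_ord0 [projF F]flatmx0 mulmx0; do !split.
have [s Cs sE] := john_target_in_cone bK bL L0 KL maxK.
(* Terms of weight zero are dropped, since the weights must be strictly positive. *)
pose s' := [seq q <- s | q.1 != 0].
have Cs' q : q \in s' -> 0 < q.1 /\ exists vp : 'rV[R]_n.+1 * 'rV[R]_n.+1,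
    [/\ K vp.1, polar L vp.2, dotp vp.1 vp.2 = 1 &
        q.2 = john_embedding (projF F) vp.2 vp.1].
  rewrite mem_filter => /andP[q0 /Cs[q1 [vp [[Kv Lp] vp1] <-]]].
  by split; [rewrite lt_def q0|exists vp].
pose m := size s'; pose q i := tnth (in_tuple s') i.
have [f fP] := choice (fun i => proj2 (Cs' (q i) (mem_tnth i (in_tuple s')))).
pose a i := (q i).1; pose p i := (f i).2; pose v i := (f i).1.
have a0 i : 0 < a i by have [] := Cs' (q i) (mem_tnth i (in_tuple s')).
have targetE : \sum_i a i *: john_embedding (projF F) (p i) (v i) = john_target (projF F).
  rewrite sE /conic_sum [RHS](bigID (fun q => q.1 != 0))/= [X in _ = _ + X]big1 => [|j]; last first.
    by move=> /negbNE/eqP ->; rewrite scale0r.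
  rewrite addr0 -[RHS]big_filter [RHS]big_tnth; apply: eq_bigr => i _.
  by have [_ _ _ <-] := fP i.
have n0 : n.+1%:R != 0 :> R by rewrite pnatr_eq0.
pose T := \sum_i a i *: tensor (p i) (v i).
(* The required identities, up to the factor [n.+1], are now read off [targetE] block by block. *)
have PTP : projF F *m T *m projF F = n.+1%:R^-1 *: projF F.
  have := congr1 (fun x => vec_mx (lsubmx x)) targetE.
  rewrite row_mxKl mxvecK !linear_sum/= => <-.
  rewrite mulmx_suml; apply: eq_bigr => i _.
  by rewrite !linearZ/= row_mxKl mxvecK -scalemxAl.
have trT : T^T = \sum_i a i *: tensor (v i) (p i).
  by rewrite /T linear_sum; apply: eq_bigr => i _; rewrite linearZ/= trmx_tensor.
have symT : T = T^T.
  have T0 := congr1 (fun x => vec_mx (lsubmx (rsubmx x))) targetE.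
  rewrite row_mxKr row_mxKl mxvecK !linear_sum/= in T0.
  apply: subr0_eq; rewrite trT -sumrB -[RHS]T0.
  apply: eq_bigr => i _.
  by rewrite -scalerBr !linearZ/= row_mxKr row_mxKl mxvecK trmx_tensor.
have sum_p : \sum_i a i *: p i = 0.
  have p0 := congr1 (fun x => lsubmx (rsubmx (rsubmx x))) targetE.
  rewrite !row_mxKr row_mxKl !linear_sum/= in p0.
  rewrite -[RHS]p0; apply: eq_bigr => i _.
  by rewrite !linearZ/= !row_mxKr row_mxKl.
have sum_a : \sum_i a i = 1.
  have := congr1 (fun x => dotp x (john_height R n)) targetE.
  rewrite dotp_suml john_target_height => <-; apply: eq_bigr => i _.
  by rewrite dotpZl john_embedding_height mulr1.
exists m, v, p, (fun i => n.+1%:R * a i); split.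
  move=> i; split; last by rewrite mulr_gt0// ltr0n.
  by have [Kv Lp vp1 _] := fP i; exact: contact_pair_of_dotp1.
have scaleT (V : lmodType R) (G : 'I_m -> V) :
    \sum_i (n.+1%:R * a i) *: G i = n.+1%:R *: \sum_i a i *: G i.
  by rewrite scaler_sumr; apply: eq_bigr => i _; rewrite scalerA.
rewrite /= !scaleT -/T sum_p scaler0 -mulr_sumr sum_a mulr1.
split; [|split=> //; split; [|split=> //]].
- by rewrite -scalemxAr -scalemxAl PTP scalerA mulfV// scale1r.
(* Each tensor of a contact pair has trace [dotp p v = 1], so the trace equals the total weight. *)
- rewrite linearZ linear_sum/= (eq_bigr a) ?sum_a ?mulr1// => i _.
  have [_ _ vp1 _] := fP i.
  by rewrite linearZ/= mxtrace_tensor dotpC vp1 mulr1.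
- by rewrite -trT -symT.
Qed.
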